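(* Let $F:(M,\nabla,g_1)\to(N,\nabla^2,g_2)$ be a statistical submersion between two statistical manifolds, with $r=\dim\mathcal V$ and $s=\dim\mathcal H$. Then for every $p\in M$ and every unit horizontal vector $h_1\in\mathcal H_p$, $$ \begin{aligned} \operatorname{Ric}^M_{\mathcal H}(h_1)\le{}&\operatorname{Ric}^{\mathcal H}(h_1)+\frac14\|\operatorname{trace}A\|^2+\frac18\sum_{\alpha=1}^r\sum_{j=2}^s(A^{*\alpha}_{1j})^2\\ &-2\sum_{\alpha=1}^r\sum_{j=2}^s\left(A^\alpha_{1j}+\frac14A^{*\alpha}_{1j}\right)^2. \end{aligned} $$ Consequently, $$\operatorname{Ric}^M_{\mathcal H}(h_1)\le\operatorname{Ric}^{\mathcal H}(h_1)+\frac14\|\operatorname{trace}A\|^2+\frac18\sum_{\alpha=1}^r\sum_{j=2}^s(A^{*\alpha}_{1j})^2.$$ Equality in the last inequality holds if and only if $$A^\alpha_{11}=\sum_{j=2}^sA^\alpha_{jj},\qquad A^\alpha_{1j}=-\frac14A^{*\alpha}_{1j}$$ for every $\alpha=1,\dots,r$ and $j=2,\dots,s$.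
   Context: A statistical manifold $(M,\nabla,g)$ is a Riemannian manifold $(M,g)$ with a torsion-free affine connection $\nabla$ for which there is a torsion-free affine connection $\nabla^*$ (the dual connection) with $Xg(Y,Z)=g(\nabla_XY,Z)+g(Y,\nabla^*_XZ)$ for all vector fields $X,Y,Z$. Let $F:(M,g_1)\to(N,g_2)$ be a Riemannian submersion, $\mathcal V=\ker F_*$ (vertical distribution), $\mathcal H=(\ker F_* )^\perp$ (horizontal distribution), $r=\dim\mathcal V$, $s=\dim\mathcal H$; $\mathcal V,\mathcal H$ also denote the orthogonal projections. If $(M,\nabla,g_1)$ and $(N,\nabla^2,g_2)$ are statistical manifolds, $F$ is a statistical submersion if $F_*(\nabla_XY)=\nabla^2_{F_*X}F_*Y$ for all basic horizontal vector fields $X,Y$. For vector fields $E,G$ on $M$ put $A_EG=\mathcal V\nabla_{\mathcal HE}\mathcal HG+\mathcal H\nabla_{\mathcal HE}\mathcal VG$, and define $A^*$ in the same way with $\nabla^*$ in place of $\nabla$. For a local orthonormal frame $\{V_1,\dots,V_r\}$ of $\mathcal V$ and $\{h_1,\dots,h_s\}$ of $\mathcal H$ (with the given unit vector as $h_1$), put $A^\alpha_{ij}=g_1(A_{h_i}h_j,V_\alpha)$, $A^{*\alpha}_{ij}=g_1(A^*_{h_i}h_j,V_\alpha)$ for $1\le i,j\le s$, $1\le\alpha\le r$; $\operatorname{trace}A=\sum_{i=1}^sA_{h_i}h_i$, so $\|\operatorname{trace}A\|^2=\sum_{\alpha=1}^r\big(\sum_{j=1}^sA^\alpha_{jj}\big)^2$.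 Curvature convention: $R(X,Y)Z=\nabla_X\nabla_YZ-\nabla_Y\nabla_XZ-\nabla_{[X,Y]}Z$ and $R(X,Y,Z,W)=g_1(R(X,Y)Z,W)$. $R^M$ is the curvature of $\nabla$ on $M$. $R^{\mathcal H}$ is the curvature associated with the horizontal distribution, i.e. $R^{\mathcal H}(X,Y)Z$ is the horizontal vector with $F_*(R^{\mathcal H}(X,Y)Z)=R^{N}(F_*X,F_*Y)F_*Z$, $R^N$ being the curvature of $\nabla^2$; it satisfies, for horizontal $U_1,\dots,U_4$, $$\begin{aligned}R^M(U_1,U_2,U_3,U_4)={}&R^{\mathcal H}(U_1,U_2,U_3,U_4)-g_1(A_{U_2}U_3,A^*_{U_1}U_4)\\&+g_1\big((A_{U_1}+A^*_{U_1})U_2,A^*_{U_3}U_4\big)+g_1(A_{U_1}U_3,A^*_{U_2}U_4).\end{aligned}$$ For a unit horizontal vector $h_1$: $\operatorname{Ric}^M_{\mathcal H}(h_1)=\sum_{j=2}^sR^M(h_1,h_j,h_j,h_1)$ and $\operatorname{Ric}^{\mathcal H}(h_1)=\sum_{j=2}^sR^{\mathcal H}(h_1,h_j,h_j,h_1)$. *)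

(* Defs.v *)
From HB Require Import structures.
From mathcomp Require Import all_boot all_order all_algebra.
From mathcomp Require Import all_classical all_reals all_analysis.

Set Implicit Arguments.
Unset Strict Implicit.
Unset Printing Implicit Defensive.

Import Order.TTheory GRing.Theory Num.Theory.
Import numFieldNormedType.Exports.

Local Open Scope classical_set_scope.
Local Open Scope ring_scope.

Section SmoothFunctions.
Context {R : realType} {V W : normedModType R}.

Definition iter_derive (vs : seq V) (f : V -> W) : V -> W :=
  foldr (fun v g => 'D_v g) f vs.

(* f is C^oo on the open set U: every iterated directional derivative of f is
   Frechet differentiable at every point of U. *)
Definition smooth_on (U : set V) (f : V -> W) : Prop :=
  forall (vs : seq V) (x : V), U x -> differentiable (iter_derive vs f) x.

End SmoothFunctions.

(* A homeomorphism crd from the open set dom onto an open subset of R^n, with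
   inverse inv; the values of crd outside dom, and those of inv outside
   crd @` dom, are irrelevant. *)
Record chart (R : realType) (n : nat) (T : topologicalType) := Chart {
  dom : set T;
  crd : T -> 'rV[R]_n;
  inv : 'rV[R]_n -> T;
  dom_open : open dom;
  img_open : open (crd @` dom);
  crdK : forall p, dom p -> inv (crd p) = p;
  crd_continuous : forall p, dom p -> {for p, continuous crd};
  inv_continuous : forall p, dom p -> {for crd p, continuous inv} }.

Record manifold (R : realType) (n : nat) := Manifold {
  points :> topologicalType;
  mfd_hausdorff : hausdorff_space points;
  mfd_second_countable : @second_countable points;
  atlas : set (chart R n points);
  atlas_cover : forall p : points, exists2 c, atlas c & dom c p;
  atlas_smooth : forall c c' : chart R n points, atlas c -> atlas c' ->
    smooth_on (crd c @` (dom c `&` dom c')) (crd c' \o inv c) }.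

Arguments atlas {R n} m _.

Section Manifolds.
Context {R : realType} {n : nat} (M : manifold R n).

(* A chosen chart of the atlas around p. The tangent space T_pM is represented
   by 'rV[R]_n: a tangent vector at p is given by its components in the chart
   chart_at p. In particular the components of a vector field at p and at q
   refer in general to different charts; coord_field gives the components in
   one fixed chart. *)
Definition chart_at (p : M) : chart R n M := s2val (cid2 (atlas_cover p)).

Definition vfield : Type := M -> 'rV[R]_n.

(* The differential at p of the chart c, as a map T_pM -> R^n. *)
Definition dchart (c : chart R n M) (p : M) (v : 'rV[R]_n) : 'rV[R]_n :=
  'd (crd c \o inv (chart_at p)) (crd (chart_at p) p) v.

Definition coord_field (c : chart R n M) (X : vfield) :
    'rV[R]_n -> 'rV[R]_n :=
  fun x => dchart c (inv c x) (X (inv c x)).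

Definition smooth_fun (U : set M) (f : M -> R) : Prop :=
  forall c, atlas M c -> smooth_on (crd c @` (U `&` dom c)) (f \o inv c).

Definition smooth_field (U : set M) (X : vfield) : Prop :=
  forall c, atlas M c -> smooth_on (crd c @` (U `&` dom c)) (coord_field c X).

(* The derivative v f of the function f along the tangent vector v at p. *)
Definition dfun (f : M -> R) (p : M) (v : 'rV[R]_n) : R :=
  'd (f \o inv (chart_at p)) (crd (chart_at p) p) v.

(* [X, Y]^i = X^j d_j Y^i - Y^j d_j X^i *)
Definition lie_bracket (X Y : vfield) : vfield := fun p =>
  let x := crd (chart_at p) p in
  let X' := coord_field (chart_at p) X in
  let Y' := coord_field (chart_at p) Y in
  'd Y' x (X' x) - 'd X' x (Y' x).

(* The vector field with constant components v in the chart chart_at p: a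
   smooth extension, on the domain of that chart, of the tangent vector v at
   p. *)
Definition extend (p : M) (v : 'rV[R]_n) : vfield := fun q =>
  'd (crd (chart_at q) \o inv (chart_at p)) (crd (chart_at p) q) v.

Record metric := Metric {
  inner :> forall p : M, 'rV[R]_n -> 'rV[R]_n -> R;
  inner_sym : forall p u v, inner p u v = inner p v u;
  inner_linear : forall p a u v w,
    inner p (a *: u + v) w = a * inner p u w + inner p v w;
  inner_pos : forall p u, u != 0 -> 0 < inner p u u;
  inner_smooth : forall (U : set M) (X Y : vfield), open U ->
    smooth_field U X -> smooth_field U Y ->
    smooth_fun U (fun p => inner p (X p) (Y p)) }.

(* A vector field over an open set U is a function on M that is smooth on U,
   its values outside U being irrelevant. An affine connection acts on the
   vector fields over every open set U. Its compatibility with restriction to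
   smaller open sets follows from cov_linearl and cov_leibniz, with the
   indicator function of U as f. *)
Record connection := Connection {
  cov :> vfield -> vfield -> vfield;
  cov_smooth : forall (U : set M) (X Y : vfield), open U ->
    smooth_field U X -> smooth_field U Y -> smooth_field U (cov X Y);
  cov_linearl : forall (U : set M) (f : M -> R) (X X' Y : vfield), open U ->
    smooth_fun U f ->
    smooth_field U X -> smooth_field U X' -> smooth_field U Y ->
    forall p, U p ->
    cov (fun q => f q *: X q + X' q) Y p = f p *: cov X Y p + cov X' Y p;
  cov_additiver : forall (U : set M) (X Y Y' : vfield), open U ->
    smooth_field U X -> smooth_field U Y -> smooth_field U Y' ->
    forall p, U p ->
    cov X (fun q => Y q + Y' q) p = cov X Y p + cov X Y' p;
  cov_leibniz : forall (U : set M) (f : M -> R) (X Y : vfield), open U ->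
    smooth_fun U f -> smooth_field U X -> smooth_field U Y ->
    forall p, U p ->
    cov X (fun q => f q *: Y q) p = f p *: cov X Y p + dfun f p (X p) *: Y p }.

Definition torsion_free (nabla : connection) : Prop :=
  forall (U : set M) (X Y : vfield), open U ->
    smooth_field U X -> smooth_field U Y ->
    forall p, U p -> nabla X Y p - nabla Y X p = lie_bracket X Y p.

Definition dual_connections (g : metric) (nabla nabla' : connection) : Prop :=
  forall (U : set M) (X Y Z : vfield), open U ->
    smooth_field U X -> smooth_field U Y -> smooth_field U Z ->
    forall p, U p ->
    dfun (fun q => g q (Y q) (Z q)) p (X p) =
    g p (nabla X Y p) (Z p) + g p (Y p) (nabla' X Z p).

Definition curvature (nabla : connection) (X Y Z : vfield) : vfield := fun p =>
  nabla X (nabla Y Z) p - nabla Y (nabla X Z) p - nabla (lie_bracket X Y) Z p.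

(* The curvature as a tensor on T_pM. *)
Definition curvature_at (nabla : connection) (p : M) (u v w : 'rV[R]_n) :
    'rV[R]_n :=
  curvature nabla (extend p u) (extend p v) (extend p w) p.

(* A local frame over U, orthonormal for g, of the distribution D. *)
Definition orthonormal_frame (g : metric) (U : set M)
    (D : M -> set 'rV[R]_n) (k : nat) (e : 'I_k -> vfield) : Prop :=
  (forall i, smooth_field U (e i)) /\
  (forall q, U q ->
    [/\ forall i, D q (e i q),
        forall i j, g q (e i q) (e j q) = (i == j)%:R
      & forall u, D q u -> exists a : 'I_k -> R, u = \sum_i a i *: e i q]).

End Manifolds.

(* The dual connection is recorded along with the connection. *)
Record statistical_manifold (R : realType) (n : nat) := StatisticalManifold {
  stat_mfd :> manifold R n;
  stat_metric : metric stat_mfd;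
  stat_conn : connection stat_mfd;
  stat_dual : connection stat_mfd;
  stat_conn_torsion_free : torsion_free stat_conn;
  stat_dual_torsion_free : torsion_free stat_dual;
  stat_duality : dual_connections stat_metric stat_conn stat_dual }.

Section Submersions.
Context {R : realType} {m n : nat}.
Variables (M : statistical_manifold R m) (N : statistical_manifold R n).
Variable F : M -> N.

Local Notation g1 := (stat_metric M).
Local Notation g2 := (stat_metric N).

Definition smooth_map : Prop :=
  continuous F /\
  forall c c', atlas M c -> atlas N c' ->
    smooth_on (crd c @` (dom c `&` F @^-1` dom c')) (crd c' \o F \o inv c).

(* F_* at p, as a map T_pM -> T_{F(p)}N. *)
Definition dmap (p : M) (v : 'rV[R]_m) : 'rV[R]_n :=
  'd (crd (chart_at (F p)) \o F \o inv (chart_at p)) (crd (chart_at p) p) v.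

Definition vertical (p : M) : set 'rV[R]_m := [set v | dmap p v = 0].

Definition horizontal (p : M) : set 'rV[R]_m :=
  [set u | forall v, vertical p v -> g1 p u v = 0].

Definition vproj (p : M) (u : 'rV[R]_m) : 'rV[R]_m :=
  xget 0 [set v | vertical p v /\ horizontal p (u - v)].

Definition hproj (p : M) (u : 'rV[R]_m) : 'rV[R]_m := u - vproj p u.

Definition riemannian_submersion : Prop :=
  [/\ smooth_map,
      forall p (w : 'rV[R]_n), exists u : 'rV[R]_m, dmap p u = w
    & forall p u v, horizontal p u -> horizontal p v ->
        g2 (F p) (dmap p u) (dmap p v) = g1 p u v].

(* X is a basic horizontal field over F^-1(W), F-related to the field X' over
   the open subset W of N. *)
Definition basic (W : set N) (X : vfield M) (X' : vfield N) : Prop :=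
  [/\ smooth_field (F @^-1` W) X, smooth_field W X'
    & forall p, W (F p) -> horizontal p (X p) /\ dmap p (X p) = X' (F p)].

Definition statistical_submersion : Prop :=
  riemannian_submersion /\
  forall (W : set N) (X Y : vfield M) (X' Y' : vfield N), open W ->
    basic W X X' -> basic W Y Y' ->
    forall p, W (F p) ->
    dmap p (stat_conn M X Y p) = stat_conn N X' Y' (F p).

Definition Atensor (nabla : connection M) (E G : vfield M) : vfield M :=
  let hE := fun q => hproj q (E q) in
  let hG := fun q => hproj q (G q) in
  let vG := fun q => vproj q (G q) in
  fun p => vproj p (nabla hE hG p) + hproj p (nabla hE vG p).

Definition curvM (p : M) (u v w z : 'rV[R]_m) : R :=
  g1 p (curvature_at (stat_conn M) p u v w) z.

(* The horizontal vector z with F_* z = R^N(F_* u, F_* v) F_* w. *)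
Definition curvH_vec (p : M) (u v w : 'rV[R]_m) : 'rV[R]_m :=
  xget 0 [set z | horizontal p z /\
    dmap p z = curvature_at (stat_conn N) (F p) (dmap p u) (dmap p v)
                 (dmap p w)].

Definition curvH (p : M) (u v w z : 'rV[R]_m) : R :=
  g1 p (curvH_vec p u v w) z.

(* h is an orthonormal basis of the horizontal space at p; the Ricci
   curvatures below are those of its first vector h ord0. *)
Definition RicM (p : M) (s : nat) (h : 'I_s.+1 -> 'rV[R]_m) : R :=
  \sum_(j < s.+1 | j != ord0) curvM p (h ord0) (h j) (h j) (h ord0).

Definition RicH (p : M) (s : nat) (h : 'I_s.+1 -> 'rV[R]_m) : R :=
  \sum_(j < s.+1 | j != ord0) curvH p (h ord0) (h j) (h j) (h ord0).

Definition traceA (s : nat) (h : 'I_s.+1 -> vfield M) : vfield M :=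
  fun p => \sum_(i < s.+1) Atensor (stat_conn M) (h i) (h i) p.

End Submersions.

(* Main.v *)
Require Import Defs.
From HB Require Import structures.
From mathcomp Require Import all_boot all_order all_algebra.
From mathcomp Require Import all_classical all_reals all_analysis.
From mathcomp Require Import ring lra.

Set Implicit Arguments.
Unset Strict Implicit.
Unset Printing Implicit Defensive.

Import Order.TTheory GRing.Theory Num.Theory.
Import numFieldNormedType.Exports.

Local Open Scope classical_set_scope.
Local Open Scope ring_scope.

(** The inequality is an identity from which two sums of squares are dropped.

Write [A_ij] and [A*_ij] for the components, along a vertical frame vector, of
the tensors built from the connection and from its dual.  Two facts about a
statistical submersion F enter.

- [second_form_skew]: [A*_X Y = - A_Y X] for horizontal X and Y.  If X and Y
  are basic, g1(X, Y) is the pullback of a function on N, so a vertical V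
  annihilates it.  Duality splits [V g1(X, Y)] into [g1(nabla_V X, Y)] and
  [g1(X, nabla*_V Y)]; both connections are torsion-free and [[V, X]] is
  vertical, so V and the basic field can be exchanged, and duality once more
  turns the two terms into [- g1(V, nabla*_X Y)] and [- g1(nabla_Y X, V)].

- [gauss_equation]: for basic X, Y, Z, the field [nabla_Y Z] is the horizontal
  lift of the covariant derivative on N plus a vertical field T.  The lift is
  again basic, so its derivative is computed on N.  The derivative of T along X,
  tested against a horizontal W, is [- g1(T, nabla*_X W)] by duality.  In the term
  with the bracket, the vertical part S of [[X, Y]] contributes
  [- g1(S, nabla*_Z W)], after S and Z have been exchanged as above.

With the arguments [h_1, h_j, h_j, h_1] these give [sectional_identity]: the
curvatures of M and of N differ by the sum over the vertical frame of
[A_11 A_jj - 2 A_1j^2 - A_1j A*_1j].  Summing over j and completing squares by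

  [- 2 x^2 - x y = y^2/8 - 2 (x + y/4)^2]  and
  [a b = (a + b)^2/4 - (a - b)^2/4]

with [x = A_1j], [y = A*_1j], [a = A_11] and [b] the sum of the other [A_jj],
gives [ricci_algebra], from which the two inequalities and the equality case
can be read off.

The curvature of the statement is evaluated on coordinate fields and the tensor
A on an orthonormal frame, whereas both facts above are about basic fields.
Hence most of the work is to show that these quantities depend only on the
values of the fields at one point ([tensorial], [curvature_tensor],
[second_form_tensor]) and that basic fields with prescribed values exist
([smooth_hlift]).  Two places need the symmetry of second derivatives
([derive_comm]): the curvature is linear over functions in its third argument,
and the Lie bracket is natural ([related_bracket]). *)

(* [inv] also names the inverse of a bundled function; here it is that of a chart. *)
Local Notation inv := Defs.inv.

(** * Smooth functions on open subsets of a normed space *)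

Section NearEq.
Context {R : realType} {V W : normedModType R}.
Implicit Types f g : V -> W.

Lemma near_eq_diff_locally f g x : {near x, f =1 g} -> differentiable f x ->
  g \o shift x = cst (g x) + 'd f x +o_ 0 id.
Proof.
move=> fg df; have fgx := nbhs_singleton fg.
have := diff_locally df; move/eqaddoP => h.
apply/eqaddoP => e e0; have h' := h e e0.
have fg0 : \forall y \near (0 : V), f (y + x) = g (y + x).
  by move: fg; rewrite (near_shift 0 x) /=; apply: filterS => y /=; rewrite subr0.
near=> y; have fgy : f (y + x) = g (y + x) by near: y.
rewrite [X in X <= _](_ : _ =
  `|((f \o shift x) - (cst (f x) + 'd f x)) y|); first by near: y.
by rewrite /GRing.add /GRing.opp /= /cst /= -fgx -fgy.
Unshelve. all: by end_near. Qed.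

Lemma near_eq_diff f g x : {near x, f =1 g} -> differentiable f x ->
  'd g x = 'd f x :> (V -> W).
Proof.
move=> fg df; apply: diff_unique; last exact: near_eq_diff_locally.
exact: diff_continuous.
Qed.

Lemma near_eq_differentiable f g x : {near x, f =1 g} -> differentiable f x ->
  differentiable g x.
Proof.
move=> fg df; apply/diff_locallyP; rewrite (near_eq_diff fg df); split.
  exact: diff_continuous.
exact: near_eq_diff_locally.
Qed.

Lemma open_near_eq (U : set V) f g x : open U -> U x ->
  (forall y, U y -> f y = g y) -> {near x, f =1 g}.
Proof.
by move=> oU Ux fg; apply: filterS (open_nbhs_nbhs (conj oU Ux)) => y /fg.
Qed.

End NearEq.

(** The chain rule when the composite is only known near x, and with a free name
    for the point where g is differentiated: changes of chart compose only on the
    overlaps, and up to the cancellation of a chart with its inverse. *)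
Lemma diff_factor {R : realType} {V V' W : normedModType R} (U : set V)
    (f : V -> V') (g : V' -> W) (h : V -> W) x y v :
  open U -> U x -> (forall z, U z -> g (f z) = h z) -> f x = y ->
  differentiable f x -> differentiable g y ->
  'd h x v = 'd g y ('d f x v).
Proof.
move=> oU Ux gfh <- df dg; rewrite (near_eq_diff (f := g \o f)).
- by rewrite diff_comp.
- exact: (open_near_eq (f := g \o f) oU Ux gfh).
- exact: differentiable_comp.
Qed.

Section SmoothOn.
Context {R : realType} {V W : normedModType R}.
Implicit Types (U : set V) (f g : V -> W).

Lemma smooth_on_differentiable U f x : smooth_on U f -> U x ->
  differentiable f x.
Proof. by move=> sf Ux; exact: (sf [::] x Ux). Qed.

Lemma smooth_on_derive U f v : smooth_on U f -> smooth_on U ('D_v f).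
Proof.
by move=> sf vs x Ux; have := sf (rcons vs v) x Ux; rewrite /iter_derive foldr_rcons.
Qed.

Lemma smooth_onS U U' f : U' `<=` U -> smooth_on U f -> smooth_on U' f.
Proof. by move=> U'U sf vs x /U'U /sf. Qed.

(** Coinduction: since P is stable under derivation up to equality on U, every
    iterated derivative of a member of P agrees on U with a member of P. *)
Lemma smooth_on_coind U (P : (V -> W) -> Prop) : open U ->
  (forall f x, P f -> U x -> differentiable f x) ->
  (forall f v, P f -> exists2 g, P g & forall x, U x -> 'D_v f x = g x) ->
  forall f, P f -> smooth_on U f.
Proof.
move=> oU Pd PD f Pf.
have key vs : exists2 g, P g & forall x, U x -> iter_derive vs f x = g x.
  elim: vs => [|v vs [g Pg fg]]; first by exists f.
  have [h Ph gh] := PD g v Pg; exists h => // x Ux; rewrite -gh //=.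
  exact/near_eq_derive/(open_near_eq oU).
move=> vs x Ux; have [g Pg fg] := key vs.
apply: (@near_eq_differentiable _ _ _ g); last exact: Pd.
by apply: (open_near_eq oU) => // y Uy; rewrite fg.
Qed.

Lemma eq_smooth_on U f g : open U -> (forall x, U x -> f x = g x) ->
  smooth_on U f -> smooth_on U g.
Proof.
move=> oU fg sf.
apply: (@smooth_on_coind U
  (fun h => exists2 k, smooth_on U k & forall x, U x -> k x = h x)) => //.
- move=> h x [k sk kh] Ux; apply: near_eq_differentiable.
    exact: (open_near_eq oU Ux kh).
  exact: smooth_on_differentiable sk Ux.
- move=> h v [k sk kh]; exists ('D_v k).
    by exists ('D_v k) => //; exact: smooth_on_derive.
  by move=> x Ux; apply/near_eq_derive/(open_near_eq oU) => // y Uy; rewrite kh.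
- by exists f.
Qed.

Lemma smooth_on_local U f :
  (forall x, U x -> exists U', [/\ U' x & smooth_on U' f]) -> smooth_on U f.
Proof. by move=> loc vs x /loc[U' [U'x sf]]; exact: sf. Qed.

Lemma smooth_on_cst U (a : W) : smooth_on U (cst a).
Proof.
have key vs : exists b : W, iter_derive vs (cst a : V -> W) = cst b.
  elim: vs => [|v vs [b IH]]; first by exists a.
  by exists 0; rewrite /= IH; apply/funext => x; rewrite derive_cst.
by move=> vs x _; have [b ->] := key vs; exact: differentiable_cst.
Qed.

End SmoothOn.

Section Algebra.
Context {R : realType} {V : normedModType R}.
Implicit Types (U : set V) (f g : V -> R).

Inductive gen_alg (P : (V -> R) -> Prop) : (V -> R) -> Prop :=
| gen_alg_base f : P f -> gen_alg P f
| gen_alg_add f g : gen_alg P f -> gen_alg P g -> gen_alg P (f + g)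
| gen_alg_mul f g : gen_alg P f -> gen_alg P g -> gen_alg P (f * g).

(** By the Leibniz rule the algebra generated by P is stable under derivation as
    soon as it contains the derivatives of the generators. Sums, products,
    inverses and composites are all handled by a choice of P. *)
Lemma smooth_on_alg U (P : (V -> R) -> Prop) : open U ->
  (forall f x, P f -> U x -> differentiable f x) ->
  (forall f v, P f -> exists2 g, gen_alg P g & forall x, U x -> 'D_v f x = g x) ->
  forall f, gen_alg P f -> smooth_on U f.
Proof.
move=> oU Pd PD.
have ad f x : gen_alg P f -> U x -> differentiable f x.
  move=> Pf Ux; elim: Pf => {f} [f Pf|f g _ df _ dg|f g _ df _ dg].
  - exact: Pd.
  - exact: differentiableD.
  - exact: differentiableM.
apply: smooth_on_coind => // f v; elim=> {f} [f Pf||].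
- by have [g Pg fg] := PD f v Pf; exists g.
- move=> f g Pf [df adf fdf] Pg [dg adg gdg]; exists (df + dg).
    exact: gen_alg_add.
  move=> x Ux; rewrite deriveD; [by rewrite fdf ?gdg| |];
    by apply: diff_derivable; apply: ad.
- move=> f g Pf [df adf fdf] Pg [dg adg gdg]; exists (f * dg + g * df).
    by apply: gen_alg_add; apply: gen_alg_mul.
  move=> x Ux; rewrite deriveM; [by rewrite fdf ?gdg| |];
    by apply: diff_derivable; apply: ad.
Qed.

Lemma smooth_on_alg_smooth U f : open U -> gen_alg (smooth_on U) f -> smooth_on U f.
Proof.
move=> oU; apply: smooth_on_alg => // {}f.
  by move=> x; exact: smooth_on_differentiable.
by move=> v sf; exists ('D_v f) => //; apply/gen_alg_base/smooth_on_derive.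
Qed.

Lemma smooth_onD U f g : open U -> smooth_on U f -> smooth_on U g ->
  smooth_on U (fun x => f x + g x).
Proof.
by move=> oU sf sg; apply: smooth_on_alg_smooth => //; apply: gen_alg_add; exact: gen_alg_base.
Qed.

Lemma smooth_onM U f g : open U -> smooth_on U f -> smooth_on U g ->
  smooth_on U (fun x => f x * g x).
Proof.
by move=> oU sf sg; apply: smooth_on_alg_smooth => //; apply: gen_alg_mul; exact: gen_alg_base.
Qed.

Lemma smooth_on_sum (I : Type) (r : seq I) (P : pred I) U (F : I -> V -> R) : open U ->
  (forall i, smooth_on U (F i)) -> smooth_on U (fun x => \sum_(i <- r | P i) F i x).
Proof.
move=> oU sF; elim: r => [|i r IH].
  rewrite (_ : (fun _ => _) = cst 0); first exact: smooth_on_cst.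
  by apply/funext => x; rewrite big_nil.
under eq_fun do rewrite big_cons; case: (P i) => //; exact: smooth_onD.
Qed.

Lemma smooth_on_prod (I : Type) (r : seq I) (P : pred I) U (F : I -> V -> R) : open U ->
  (forall i, smooth_on U (F i)) -> smooth_on U (fun x => \prod_(i <- r | P i) F i x).
Proof.
move=> oU sF; elim: r => [|i r IH].
  rewrite (_ : (fun _ => _) = cst 1); first exact: smooth_on_cst.
  by apply/funext => x; rewrite big_nil.
under eq_fun do rewrite big_cons; case: (P i) => //; exact: smooth_onM.
Qed.

Lemma smooth_onV U f : open U -> (forall x, U x -> f x != 0) ->
  smooth_on U f -> smooth_on U (fun x => (f x)^-1).
Proof.
move=> oU f0 sf; set h := fun x => (f x)^-1.
apply: (@smooth_on_alg U (fun k => smooth_on U k \/ k = h)) => //.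
- move=> k x [sk|->] Ux; first exact: smooth_on_differentiable sk Ux.
  by apply: differentiableV; [exact: smooth_on_differentiable sf Ux|exact: f0].
- move=> k v [sk|->].
    by exists ('D_v k) => //; apply: gen_alg_base; left; exact: smooth_on_derive.
  exists (cst (-1) * (h * h) * 'D_v f).
    apply: gen_alg_mul; last by apply: gen_alg_base; left; exact: smooth_on_derive.
    apply: gen_alg_mul; first by apply: gen_alg_base; left; exact: smooth_on_cst.
    by apply: gen_alg_mul; apply: gen_alg_base; right.
  move=> x Ux; rewrite /h deriveV; last 2 first.
  + exact: f0.
  + exact/diff_derivable/(smooth_on_differentiable sf Ux).
  by rewrite /GRing.mul /= /cst /= mulN1r -expr2 exprVn.
- by apply: gen_alg_base; right.
Qed.

Lemma smooth_on_det n U (G : V -> 'M[R]_n) : open U ->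
  (forall i j, smooth_on U (fun x => G x i j)) -> smooth_on U (fun x => \det (G x)).
Proof.
move=> oU sG; rewrite /determinant; apply: smooth_on_sum => // s.
by apply: smooth_onM => //; [exact: smooth_on_cst|exact: smooth_on_prod].
Qed.

(** Cramer's rule. *)
Lemma smooth_on_invmx n U (G : V -> 'M[R]_n) i j : open U ->
  (forall x, U x -> G x \in unitmx) ->
  (forall i j, smooth_on U (fun x => G x i j)) ->
  smooth_on U (fun x => invmx (G x) i j).
Proof.
move=> oU uG sG.
apply: (@eq_smooth_on _ _ _ _
  (fun x => (\det (G x))^-1 * ((-1) ^+ (j + i) * \det (row' j (col' i (G x)))))) => //.
  by move=> x Ux; rewrite /invmx uG // !mxE.
apply: smooth_onM => //.
  apply: smooth_onV => //; last exact: smooth_on_det.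
  by move=> x /uG; rewrite unitmxE unitfE.
apply: smooth_onM => //; first exact: smooth_on_cst.
by apply: smooth_on_det => // k l; under eq_fun do rewrite !mxE; exact: sG.
Qed.

End Algebra.

(** * Vector-valued functions, composition and second derivatives *)

Section Vectors.
Context {R : realType} {V : normedModType R} {n : nat}.
Implicit Types (U : set V) (f g : V -> 'rV[R]_n).

Lemma differentiable_rV f x :
  (forall i, differentiable (fun y => f y 0 i) x) -> differentiable f x.
Proof.
move=> df; rewrite (_ : f = \sum_i (fun y => f y 0 i *: delta_mx 0 i)).
  by apply: differentiable_sum => i; exact: differentiableZl.
by apply/funext => y; rewrite fct_sumE [LHS]row_sum_delta.
Qed.

Lemma differentiable_entry f x i :
  differentiable f x -> differentiable (fun y => f y 0 i) x.
Proof.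
move=> df; apply: (@differentiable_comp _ _ _ _ f (fun v : 'rV[R]_n => v 0 i)) => //.
exact: differentiable_coord.
Qed.

Lemma derive_entry f x v i : differentiable f x ->
  'D_v (fun y => f y 0 i) x = ('D_v f x) 0 i.
Proof. by move=> df; rewrite derive_mx ?mxE //; exact: diff_derivable. Qed.

Lemma diff_entry f x v i : differentiable f x ->
  'd (fun y => f y 0 i) x v = ('d f x v) 0 i.
Proof.
move=> df; rewrite -!deriveE ?derive_entry //; exact: differentiable_entry.
Qed.

Lemma smooth_on_entry U f i : open U -> smooth_on U f ->
  smooth_on U (fun x => f x 0 i).
Proof.
move=> oU sf.
apply: (@smooth_on_coind _ _ _ U
  (fun h => exists2 g : V -> 'rV[R]_n, smooth_on U g & h = fun x => g x 0 i)) => //.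
- move=> h x [g sg ->] Ux; apply: differentiable_entry.
  exact: smooth_on_differentiable sg Ux.
- move=> h v [g sg ->]; exists (fun x => 'D_v g x 0 i).
    by exists ('D_v g) => //; exact: smooth_on_derive.
  by move=> x Ux; rewrite derive_entry //; exact: smooth_on_differentiable sg Ux.
- by exists f.
Qed.

Lemma smooth_on_rV U f : open U ->
  (forall i, smooth_on U (fun x => f x 0 i)) -> smooth_on U f.
Proof.
move=> oU.
have ad g : (forall i, smooth_on U (fun x => g x 0 i)) ->
    forall x, U x -> differentiable g x.
  move=> sg x Ux; apply: differentiable_rV => i.
  exact: smooth_on_differentiable (sg i) Ux.
apply: (smooth_on_coind oU
  (P := fun g : V -> 'rV[R]_n => forall i, smooth_on U (fun x => g x 0 i))).
- by move=> g x sg Ux; exact: ad.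
- move=> g v sg; exists ('D_v g) => // i.
  apply: (eq_smooth_on oU _ (smooth_on_derive v (sg i))) => x Ux.
  by rewrite derive_entry //; exact: ad.
Qed.

Lemma smooth_on_rVD U f g : open U -> smooth_on U f -> smooth_on U g ->
  smooth_on U (fun x => f x + g x).
Proof.
move=> oU sf sg; apply: smooth_on_rV => // i; under eq_fun do rewrite mxE.
by apply: smooth_onD => //; exact: smooth_on_entry.
Qed.

Lemma smooth_on_rVZ U (a : V -> R) f : open U -> smooth_on U a -> smooth_on U f ->
  smooth_on U (fun x => a x *: f x).
Proof.
move=> oU sa sf; apply: smooth_on_rV => // i; under eq_fun do rewrite mxE.
by apply: smooth_onM => //; exact: smooth_on_entry.
Qed.

End Vectors.

Section Composition.
Context {R : realType} {V : normedModType R} {m : nat}.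

Lemma diff_sum_derive {W : normedModType R} (f : 'rV[R]_m -> W) x v :
  differentiable f x -> 'd f x v = \sum_i v 0 i *: 'D_(delta_mx 0 i) f x.
Proof.
move=> df; rewrite {1}(row_sum_delta v) linear_sum /=.
by apply: eq_bigr => i _; rewrite linearZ deriveE.
Qed.

(** The derivative of [h \o f] along v is the sum of the [D_v f_i * (D_i h \o f)],
    which lies in the algebra generated by the smooth functions and the
    composites with f. *)
Lemma smooth_on_comp_scalar (U : set V) (U' : set 'rV[R]_m)
    (f : V -> 'rV[R]_m) (g : 'rV[R]_m -> R) :
  open U -> (forall x, U x -> U' (f x)) ->
  smooth_on U f -> smooth_on U' g -> smooth_on U (g \o f).
Proof.
move=> oU UU' sf sg.
have dc h x : smooth_on U' h -> U x -> differentiable (h \o f : V -> R) x.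
  move=> sh Ux; apply: differentiable_comp.
    exact: smooth_on_differentiable sf Ux.
  exact: smooth_on_differentiable sh (UU' _ Ux).
pose P k := smooth_on U k \/ exists2 h : 'rV[R]_m -> R, smooth_on U' h & k = h \o f.
apply: (@smooth_on_alg _ _ U P) => //.
- move=> k x [sk|[h sh ->]] Ux; first exact: smooth_on_differentiable sk Ux.
  exact: dc.
- move=> k v [sk|[h sh ->]].
    by exists ('D_v k) => //; apply: gen_alg_base; left; exact: smooth_on_derive.
  exists (\sum_i (fun y => 'D_v f y 0 i) * ('D_(delta_mx 0 i) h \o f)).
    apply: (big_ind (gen_alg P)).
    + by apply: gen_alg_base; left; exact: smooth_on_cst.
    + exact: gen_alg_add.
    + move=> i _; apply: gen_alg_mul; apply: gen_alg_base.
        by left; apply: smooth_on_entry => //; exact: smooth_on_derive.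
      by right; exists ('D_(delta_mx 0 i) h) => //; exact: smooth_on_derive.
  move=> x Ux; have dfx := smooth_on_differentiable sf Ux.
  have dhx := smooth_on_differentiable sh (UU' _ Ux).
  rewrite deriveE; last exact: dc.
  rewrite diff_comp //= diff_sum_derive // fct_sumE; apply: eq_bigr => i _.
  by rewrite -(deriveE v dfx).
- by apply: gen_alg_base; right; exists g.
Qed.

Lemma smooth_on_comp {n} (U : set V) (U' : set 'rV[R]_m)
    (f : V -> 'rV[R]_m) (g : 'rV[R]_m -> 'rV[R]_n) :
  open U -> (forall x, U x -> U' (f x)) -> open U' ->
  smooth_on U f -> smooth_on U' g -> smooth_on U (g \o f).
Proof.
move=> oU UU' oU' sf sg; apply: smooth_on_rV => // i.
apply: (smooth_on_comp_scalar (g := fun y => g y 0 i) oU UU') => //.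
exact: smooth_on_entry.
Qed.

Lemma smooth_on_diff_scalar (U : set 'rV[R]_m) (f : 'rV[R]_m -> R)
    (X : 'rV[R]_m -> 'rV[R]_m) :
  open U -> smooth_on U f -> smooth_on U X -> smooth_on U (fun x => 'd f x (X x)).
Proof.
move=> oU sf sX.
apply: (@eq_smooth_on _ _ _ _ (fun x => \sum_i X x 0 i * 'D_(delta_mx 0 i) f x)) => //.
  move=> x Ux; rewrite diff_sum_derive //; exact: smooth_on_differentiable sf Ux.
apply: smooth_on_sum => // i; apply: smooth_onM => //.
  exact: smooth_on_entry.
exact: smooth_on_derive.
Qed.

Lemma smooth_on_diff {n} (U : set 'rV[R]_m) (f : 'rV[R]_m -> 'rV[R]_n)
    (X : 'rV[R]_m -> 'rV[R]_m) :
  open U -> smooth_on U f -> smooth_on U X -> smooth_on U (fun x => 'd f x (X x)).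
Proof.
move=> oU sf sX; apply: smooth_on_rV => // i.
apply: (@eq_smooth_on _ _ _ _ (fun x => 'd (fun y => f y 0 i) x (X x))) => //.
  by move=> x Ux; rewrite diff_entry //; exact: smooth_on_differentiable sf Ux.
by apply: smooth_on_diff_scalar => //; exact: smooth_on_entry.
Qed.

End Composition.

Section Schwarz.
Context {R : realType} {V : normedModType R}.
Implicit Type f : V -> R.

(** The mean value theorem for [s |-> f (x + s u + t v) - f (x + s u)] expresses
    the second difference by values of [D_u f] at distance O(t) from x, where
    [D_u f] is affine up to o(t). *)
Lemma second_difference f x u v :
  (\forall y \near x, differentiable f y) -> differentiable ('D_u f) x ->
  forall e, 0 < e -> \forall t \near (0 : R)^'+,
    `|f (x + t *: u + t *: v) - f (x + t *: u) - f (x + t *: v) + f x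
      - t ^+ 2 * 'd ('D_u f) x v| <= e * t ^+ 2.
Proof.
move=> nf du e e0; set L := 'd ('D_u f) x.
(* The two error terms below are at most (e / c) t (|u| + |v|) and (e / c) t |u|;
   the summand 1 keeps c positive. *)
pose c := 2 * `|u| + `|v| + 1.
have c0 : 0 < c by rewrite ltr_wpDl // addr_ge0 // mulr_ge0.
have ec : 0 < e / c by rewrite divr_gt0.
pose r y := 'D_u f (y + x) - 'D_u f x - L y.
have nr : \forall y \near (0 : V),
    differentiable f (y + x) /\ `|r y| <= e / c * `|y|.
  near=> y; split.
    near: y; move: nf; rewrite (near_shift 0 x) /=.
    by apply: filterS => y /=; rewrite subr0.
  rewrite /r; near: y.
  have := diff_locally du; move/eqaddoP => /(_ _ ec); apply: filterS => y.
  by rewrite /GRing.add /GRing.opp /= /cst /= opprD addrA.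
move/nbhs_ballP : nr => [d /= d0 hd].
near=> t.
have t0 : 0 < t by near: t; exact: nbhs_right_gt.
have tc : t * c < d.
  by rewrite -ltr_pdivlMr //; near: t; apply: nbhs_right_lt; rewrite divr_gt0.
have small a b : 0 <= a <= t -> 0 <= b <= t -> `|a *: u + b *: v| <= t * (`|u| + `|v|).
  move=> /andP[a0 at_] /andP[b0 bt]; apply: le_trans (ler_normD _ _) _.
  by rewrite !normrZ !ger0_norm // mulrDr lerD // ler_wpM2r.
have inball a b : 0 <= a <= t -> 0 <= b <= t -> ball 0 d (a *: u + b *: v).
  move=> ha hb; rewrite -ball_normE /= sub0r normrN.
  apply: le_lt_trans (small _ _ ha hb) (le_lt_trans _ tc).
  rewrite ler_pM2l // /c; have := normr_ge0 u; lra.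
have tt : 0 <= t <= t by rewrite lexx ltW.
have t00 : 0 <= (0 : R) <= t by rewrite lexx ltW.
pose phi s := f (s *: u + t *: v + x) - f (s *: u + 0 *: v + x).
pose dphi s := 'D_u f (s *: u + t *: v + x) - 'D_u f (s *: u + 0 *: v + x).
have dline s b : 0 <= s <= t -> 0 <= b <= t ->
    is_derive s 1 (fun s' : R => f (s' *: u + b *: v + x)) ('D_u f (s *: u + b *: v + x)).
  move=> hs hb; have [dfs _] := hd _ (inball _ _ hs hb).
  pose l := fun s' : R => s' *: u + (b *: v + x).
  have dl : is_diff s l ( *:%R ^~ u).
    have -> : l = *:%R ^~ u + cst (b *: v + x) by [].
    by apply: is_diff_eq; rewrite addr0.
  have -> : (fun s' : R => f (s' *: u + b *: v + x)) = f \o l.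
    by apply/funext => s'; rewrite /l /= addrA.
  have dfl : differentiable f (l s) by rewrite /l addrA.
  have dfc : differentiable (f \o l) s by apply: differentiable_comp => //.
  apply: DeriveDef; first exact: diff_derivable.
  rewrite deriveE // diff_comp //= diff_val scale1r /l addrA.
  by rewrite deriveE.
have dphiE s : s \in `[0, t] -> is_derive s 1 phi (dphi s).
  by rewrite in_itv /= => hs; apply: is_deriveB; exact: dline.
have cphi : {within `[0, t], continuous phi}.
  apply: derivable_within_continuous => s hs.
  by have [] := dphiE s hs.
have dphi_oo s : s \in `]0, t[ -> is_derive s 1 phi (dphi s).
  by move=> hs; apply: dphiE; exact: subset_itv_oo_cc hs.
have [s] := MVT_segment (ltW t0) dphi_oo cphi.
rewrite in_itv /= => hs; rewrite subr0 => E.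
have E1 : f (x + t *: u + t *: v) - f (x + t *: u) - f (x + t *: v) + f x = dphi s * t.
  rewrite -E /phi !scale0r !add0r !addr0.
  have -> : x + t *: u + t *: v = t *: u + t *: v + x by rewrite -addrA addrC.
  rewrite (addrC x (t *: u)) (addrC x (t *: v)); ring.
have E2 : dphi s = t * L v + (r (s *: u + t *: v) - r (s *: u + 0 *: v)).
  have LZ a w : L (a *: w) = a * L w by rewrite linearZ.
  have LD w w' : L (w + w') = L w + L w' by rewrite linearD.
  rewrite /dphi /r !LD !LZ; ring.
rewrite E1 E2.
have -> : (t * L v + (r (s *: u + t *: v) - r (s *: u + 0 *: v))) * t - t ^+ 2 * L v
   = t * (r (s *: u + t *: v) - r (s *: u + 0 *: v)) by ring.
rewrite normrM (gtr0_norm t0).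
have r1 : `|r (s *: u + t *: v)| <= e / c * (t * (`|u| + `|v|)).
  have [_ h] := hd _ (inball _ _ hs tt); apply: le_trans h _.
  by rewrite ler_pM2l //; exact: small.
have r2 : `|r (s *: u + 0 *: v)| <= e / c * (t * `|u|).
  have [_ h] := hd _ (inball _ _ hs t00); apply: le_trans h _.
  move: hs => /andP[s0 st].
  by rewrite ler_pM2l // scale0r addr0 normrZ ger0_norm // ler_wpM2r.
apply: (@le_trans _ _ (t * (e / c * (t * (c - 1))))).
  rewrite ler_pM2l //; apply: le_trans (ler_normB _ _) _; apply: le_trans (lerD r1 r2) _.
  by rewrite -mulrDr ler_pM2l // -mulrDr ler_pM2l // /c; lra.
rewrite (_ : e * t ^+ 2 = t * (e / c * (t * c))); last first.
  by field; rewrite gt_eqF.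
by rewrite !ler_pM2l // gerBl.
Unshelve. all: by end_near. Qed.

Lemma close_coefficients (S a b e t : R) : 0 < t ->
  `|S - t ^+ 2 * a| <= e / 2 * t ^+ 2 -> `|S - t ^+ 2 * b| <= e / 2 * t ^+ 2 ->
  `|b - a| <= e.
Proof.
move=> t0 h1 h2; have t2 : 0 < t ^+ 2 by rewrite exprn_gt0.
rewrite -(ler_pM2l t2) -{1}(gtr0_norm t2) -normrM.
have -> : t ^+ 2 * (b - a) = (S - t ^+ 2 * a) - (S - t ^+ 2 * b) by ring.
apply: le_trans (ler_normB _ _) _; apply: le_trans (lerD h1 h2) _.
by rewrite -mulrDl -splitr mulrC.
Qed.

(** The second difference is symmetric in u and v. *)
Lemma derive_comm f x u v :
  (\forall y \near x, differentiable f y) ->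
  differentiable ('D_u f) x -> differentiable ('D_v f) x ->
  'D_u ('D_v f) x = 'D_v ('D_u f) x.
Proof.
move=> nf du dv; rewrite !deriveE //; apply/eqP; rewrite -subr_eq0 -normr_le0.
apply/ler_addgt0Pr => e e0; rewrite add0r.
have e2 : 0 < e / 2 by rewrite divr_gt0.
have [t] : exists t, [/\ 0 < t,
    `|f (x + t *: u + t *: v) - f (x + t *: u) - f (x + t *: v) + f x
      - t ^+ 2 * 'd ('D_u f) x v| <= e / 2 * t ^+ 2 &
    `|f (x + t *: v + t *: u) - f (x + t *: v) - f (x + t *: u) + f x
      - t ^+ 2 * 'd ('D_v f) x u| <= e / 2 * t ^+ 2].
  near (0 : R)^'+ => t; exists t; split.
  - by near: t; exact: nbhs_right_gt.
  - by near: t; exact: second_difference.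
  - by near: t; exact: second_difference.
case=> t0; have -> : x + t *: v + t *: u = x + t *: u + t *: v by rewrite addrAC.
rewrite (addrAC (f (x + t *: u + t *: v)) (- f (x + t *: v))).
exact: close_coefficients t0.
Unshelve. all: by end_near. Qed.

End Schwarz.

Section Bracket.
Context {R : realType} {m : nat}.

Lemma derive_comm_smooth (U : set 'rV[R]_m) (f : 'rV[R]_m -> R) x u v :
  open U -> smooth_on U f -> U x -> 'D_u ('D_v f) x = 'D_v ('D_u f) x.
Proof.
move=> oU sf Ux; apply: derive_comm.
- by apply: filterS (open_nbhs_nbhs (conj oU Ux)) => y; exact: smooth_on_differentiable.
- exact: smooth_on_differentiable (smooth_on_derive _ sf) Ux.
- exact: smooth_on_differentiable (smooth_on_derive _ sf) Ux.
Qed.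

(** Isolates the second-derivative term, which is symmetric in X x and w. *)
Lemma diff_diff (U : set 'rV[R]_m) (f : 'rV[R]_m -> R)
    (X : 'rV[R]_m -> 'rV[R]_m) x w :
  open U -> smooth_on U f -> smooth_on U X -> U x ->
  'd (fun y => 'd f y (X y)) x w =
  'd f x ('d X x w) 
  + \sum_i \sum_j X x 0 i * w 0 j * 'D_(delta_mx 0 j) ('D_(delta_mx 0 i) f) x.
Proof.
move=> oU sf sX Ux.
have dX := smooth_on_differentiable sX Ux.
have df y : U y -> differentiable f y by exact: smooth_on_differentiable.
pose F i := (fun y => X y 0 i) * 'D_(delta_mx 0 i) f.
have sXi i := smooth_on_entry i oU sX.
have dXi i := smooth_on_differentiable (sXi i) Ux.
have sDi i := smooth_on_derive (delta_mx 0 i) sf.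
have dDi i := smooth_on_differentiable (sDi i) Ux.
rewrite (near_eq_diff (f := \sum_i F i)); last 2 first.
- apply: (open_near_eq oU Ux) => y Uy; rewrite diff_sum_derive ?fct_sumE //.
  exact: df.
- by apply: differentiable_sum => i; apply: differentiableM.
rewrite -deriveE; last by apply: differentiable_sum => i; apply: differentiableM.
rewrite derive_sum; last first.
  by move=> i; apply: diff_derivable; apply: differentiableM.
rewrite diff_sum_derive; last exact: df.
rewrite -big_split /=; apply: eq_bigr => i _.
rewrite deriveM; try exact: diff_derivable.
rewrite addrC (derive_entry _ _ dX) (deriveE _ dX); congr (_ + _).
  rewrite deriveE // diff_sum_derive // scaler_sumr; apply: eq_bigr => j _.
  exact: mulrA.
exact: mulrC.
Qed.

Lemma diff_bracket_scalar (U : set 'rV[R]_m) (f : 'rV[R]_m -> R)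
    (X Y : 'rV[R]_m -> 'rV[R]_m) x :
  open U -> smooth_on U f -> smooth_on U X -> smooth_on U Y -> U x ->
  'd f x ('d Y x (X x) - 'd X x (Y x)) =
  'd (fun y => 'd f y (Y y)) x (X x) - 'd (fun y => 'd f y (X y)) x (Y x).
Proof.
move=> oU sf sX sY Ux.
have E1 := diff_diff (X x) oU sf sY Ux.
have E2 := diff_diff (Y x) oU sf sX Ux.
apply: etrans (esym (congr2 (fun a b => a - b) E1 E2)).
apply: (etrans (linearB ('d f x) _ _));
rewrite /= opprD addrACA -[LHS]addr0; congr (_ + _); apply/esym/eqP.
rewrite subr_eq0 exchange_big; apply/eqP; apply: eq_bigr => i _.
apply: eq_bigr => j _; rewrite (derive_comm_smooth _ _ oU sf Ux).
by rewrite (mulrC (X x 0 i)).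
Qed.

(** The left-hand side is the differential of f at the Lie bracket of X and Y; the
    second derivatives of f on the right cancel by symmetry. For scalar f this is
    [[X, Y] f = X (Y f) - Y (X f)]; for a map it is the naturality of the bracket. *)
Lemma diff_bracket {n} (U : set 'rV[R]_m) (f : 'rV[R]_m -> 'rV[R]_n)
    (X Y : 'rV[R]_m -> 'rV[R]_m) x :
  open U -> smooth_on U f -> smooth_on U X -> smooth_on U Y -> U x ->
  'd f x ('d Y x (X x) - 'd X x (Y x)) =
  'd (fun y => 'd f y (Y y)) x (X x) - 'd (fun y => 'd f y (X y)) x (Y x).
Proof.
move=> oU sf sX sY Ux; apply/rowP => i; have sfi := smooth_on_entry i oU sf.
have dfx := smooth_on_differentiable sf Ux.
rewrite -diff_entry // (diff_bracket_scalar oU sfi sX sY Ux) !mxE.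
have aux (Z : 'rV[R]_m -> 'rV[R]_m) w : smooth_on U Z ->
    'd (fun y => 'd (fun z => f z 0 i) y (Z y)) x w =
    'd (fun y => 'd f y (Z y)) x w 0 i.
  move=> sZ; have sfZ := smooth_on_diff oU sf sZ.
  have dfZ := smooth_on_differentiable sfZ Ux.
  rewrite -(diff_entry w i dfZ).
  rewrite (near_eq_diff (f := fun y => 'd f y (Z y) 0 i)) //.
    apply: (open_near_eq oU Ux) => y Uy; rewrite diff_entry //.
    exact: smooth_on_differentiable sf Uy.
  exact: differentiable_entry.
exact: (congr2 (fun a b => a - b) (aux Y (X x) sY) (aux X (Y x) sX)).
Qed.

End Bracket.

(** * Charts, smooth fields and functions on a manifold *)

Section ChartImages.
Context {R : realType} {n : nat} {T : topologicalType}.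
Implicit Types (c : chart R n T) (U : set T).

Lemma img_inv c U x : (crd c @` (U `&` dom c)) x ->
  [/\ U (inv c x), dom c (inv c x) & crd c (inv c x) = x].
Proof. by move=> [q [Uq cq] <-]; rewrite crdK. Qed.

Lemma mem_img c U q : U q -> dom c q -> (crd c @` (U `&` dom c)) (crd c q).
Proof. by move=> Uq cq; exists q. Qed.

Lemma open_img c U : open U -> open (crd c @` (U `&` dom c)).
Proof.
move=> oU; rewrite openE => _ [q [Uq cq] <-].
have n1 : nbhs (crd c q) (crd c @` dom c).
  by apply: open_nbhs_nbhs; split; [exact: img_open|exists q].
have n2 : nbhs (crd c q) (inv c @^-1` (U `&` dom c)).
  have := Defs.inv_continuous cq; rewrite /prop_for /continuous_at crdK //; apply.
  by apply: open_nbhs_nbhs; split=> //; apply: openI => //; exact: dom_open.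
apply: filterS2 n1 n2 => x [q' cq' <-] /=.
by rewrite crdK // => -[Uq' _]; exists q'.
Qed.

End ChartImages.

Section Charts.
Context {R : realType} {n : nat} {M : manifold R n}.
Implicit Types (c : chart R n M) (p q : M) (U : set M) (X Y : vfield M).

Lemma chart_at_atlas p : atlas M (chart_at p).
Proof. by rewrite /chart_at; case: cid2. Qed.

Lemma chart_at_dom p : dom (chart_at p) p.
Proof. by rewrite /chart_at; case: cid2. Qed.
Hint Resolve chart_at_atlas chart_at_dom : core.

Definition transition c c' p : 'rV[R]_n -> 'rV[R]_n := 'd (crd c' \o inv c) (crd c p).

Lemma transitionD c c' p u v : transition c c' p (u + v) = transition c c' p u + transition c c' p v.
Proof. exact: linearD. Qed.

Lemma transitionZ c c' p a v : transition c c' p (a *: v) = a *: transition c c' p v.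
Proof. exact: linearZ. Qed.

Lemma transition0 c c' p : transition c c' p 0 = 0.
Proof. exact: linear0. Qed.

Lemma transition_smooth c c' : atlas M c -> atlas M c' ->
  smooth_on (crd c @` (dom c' `&` dom c)) (crd c' \o inv c).
Proof. by move=> ac ac'; rewrite setIC; exact: atlas_smooth. Qed.

Lemma transition_differentiable c c' p : atlas M c -> atlas M c' -> dom c p -> dom c' p ->
  differentiable (crd c' \o inv c) (crd c p).
Proof.
move=> ac ac' cp c'p; apply: smooth_on_differentiable (transition_smooth ac ac') _.
exact: mem_img.
Qed.

Lemma transition_comp c c' c'' p v : atlas M c -> atlas M c' -> atlas M c'' ->
  dom c p -> dom c' p -> dom c'' p ->
  transition c' c'' p (transition c c' p v) = transition c c'' p v.
Proof.
move=> ac ac' ac'' cp c'p c''p; rewrite /transition.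
have d1 := transition_differentiable ac ac' cp c'p.
have d2 := transition_differentiable ac' ac'' c'p c''p.
have E : (crd c' \o inv c) (crd c p) = crd c' p by rewrite /= crdK.
apply: esym.
apply: (diff_factor v (open_img (dom_open c')) _ _ E d1 d2).
  exact: mem_img.
by move=> x /img_inv[c'x cx _] /=; rewrite crdK.
Qed.

Lemma transition_id c p v : dom c p -> transition c c p v = v.
Proof.
move=> cp; rewrite /transition (near_eq_diff (f := id)) //.
  by rewrite (@diff_val _ _ _ _ _ _ _ (is_diff_id _)).
apply: (open_near_eq (open_img openT)); first exact: mem_img.
by move=> x /img_inv[].
Qed.

Lemma dchartE c p v : dchart c p v = transition (chart_at p) c p v.
Proof. by []. Qed.

Lemma transition_dchart c c' p v : atlas M c -> atlas M c' -> dom c p -> dom c' p ->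
  transition c c' p (dchart c p v) = dchart c' p v.
Proof. by move=> ac ac' cp c'p; rewrite !dchartE transition_comp. Qed.

Lemma dchart_at p v : dchart (chart_at p) p v = v.
Proof. by rewrite dchartE transition_id. Qed.

Definition const_field c (w : 'rV[R]_n) : vfield M := fun q => transition c (chart_at q) q w.

Lemma extendE p w : extend p w = const_field (chart_at p) w.
Proof. by []. Qed.

Lemma dchart_const_field c q w : atlas M c -> dom c q -> dchart c q (const_field c w q) = w.
Proof. by move=> ac cq; rewrite dchartE transition_comp // transition_id. Qed.

Lemma const_field_dchart c q v : atlas M c -> dom c q -> const_field c (dchart c q v) q = v.
Proof. by move=> ac cq; rewrite /const_field transition_dchart // dchart_at. Qed.

Lemma extend_at p w : extend p w p = w.
Proof. by rewrite extendE /const_field transition_id. Qed.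

Lemma const_field_sum c X q : atlas M c -> dom c q ->
  X q = \sum_i dchart c q (X q) 0 i *: const_field c (delta_mx 0 i) q.
Proof.
move=> ac cq; rewrite -[LHS](const_field_dchart _ ac cq) {1}/const_field.
rewrite {1}[dchart _ _ _]row_sum_delta /transition linear_sum; apply: eq_bigr => i _.
by rewrite linearZ.
Qed.

Lemma coord_fieldE c X q : dom c q -> coord_field c X (crd c q) = dchart c q (X q).
Proof. by move=> cq; rewrite /coord_field crdK. Qed.

Lemma coord_field_transition c c' X q : atlas M c -> atlas M c' -> dom c q -> dom c' q ->
  coord_field c' X (crd c' q) =
  'd (crd c' \o inv c) (crd c q) (coord_field c X (crd c q)).
Proof.
move=> ac ac' cq c'q; rewrite !coord_fieldE //.
exact/esym/transition_dchart.
Qed.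

(** Smoothness may be tested in one chart around each point, because the
    transition maps and their differentials are smooth. *)
Lemma smooth_field_local U X :
  (forall q, U q -> exists c U', [/\ atlas M c, dom c q, open U', U' q &
      smooth_on (crd c @` (U' `&` dom c)) (coord_field c X)]) ->
  smooth_field U X.
Proof.
move=> loc c' ac'; apply: smooth_on_local => _ [q [Uq c'q] <-].
have [c [U' [ac cq oU' U'q sX]]] := loc q Uq.
have oI : open (U' `&` dom c `&` dom c') by apply: openI (dom_open _); apply: openI (dom_open _).
exists (crd c' @` (U' `&` dom c `&` dom c' `&` dom c')); split; first by exists q.
pose T := crd c @` (U' `&` dom c `&` dom c' `&` dom c).
have oT : open T by exact: open_img.
pose G y := 'd (crd c' \o inv c) y (coord_field c X y).
have sG : smooth_on T G.
  apply: smooth_on_diff => //.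
    by apply: smooth_onS (transition_smooth ac ac') => _ [r [[[? ?] ?] ?] <-]; exact: mem_img.
  by apply: smooth_onS sX => _ [r [[[? ?] ?] ?] <-]; exact: mem_img.
have oT' := open_img (c := c') oI.
apply: (@eq_smooth_on _ _ _ _ (G \o (crd c \o inv c'))) => //.
  move=> _ [r [[[U'r cr] c'r] _] <-] /=.
  by rewrite /G crdK // (coord_field_transition X ac ac').
apply: (smooth_on_comp oT' _ oT) sG.
  by move=> _ [r [[[U'r cr] c'r] _] <-] /=; rewrite crdK //; exact: mem_img.
apply: smooth_onS (transition_smooth ac' ac) => _ [r [[[? ?] ?] ?] <-]; exact: mem_img.
Qed.

Lemma smooth_fun_local U (f : M -> R) :
  (forall q, U q -> exists c U', [/\ atlas M c, dom c q, open U', U' q &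
      smooth_on (crd c @` (U' `&` dom c)) (f \o inv c)]) ->
  smooth_fun U f.
Proof.
move=> loc c' ac'; apply: smooth_on_local => _ [q [Uq c'q] <-].
have [c [U' [ac cq oU' U'q sX]]] := loc q Uq.
have oI : open (U' `&` dom c `&` dom c') by apply: openI (dom_open _); apply: openI (dom_open _).
exists (crd c' @` (U' `&` dom c `&` dom c' `&` dom c')); split; first by exists q.
have oT' := open_img (c := c') oI.
apply: (@eq_smooth_on _ _ _ _ ((f \o inv c) \o (crd c \o inv c'))) => //.
  by move=> _ [r [[[U'r cr] c'r] _] <-] /=; rewrite !crdK.
apply: (smooth_on_comp_scalar oT' _ _ sX).
  by move=> _ [r [[[U'r cr] c'r] _] <-] /=; rewrite crdK //; exact: mem_img.
apply: smooth_onS (transition_smooth ac' ac) => _ [r [[[? ?] ?] ?] <-]; exact: mem_img.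
Qed.

Lemma smooth_field_on U X c : smooth_field U X -> atlas M c ->
  smooth_on (crd c @` (U `&` dom c)) (coord_field c X).
Proof. by move=> sX; exact: sX. Qed.

Lemma smooth_fun_on U (f : M -> R) c : smooth_fun U f -> atlas M c ->
  smooth_on (crd c @` (U `&` dom c)) (f \o inv c).
Proof. by move=> sf; exact: sf. Qed.

Lemma smooth_fieldS U U' X : U' `<=` U -> smooth_field U X -> smooth_field U' X.
Proof.
move=> UU' sX c ac; apply: smooth_onS (sX c ac) => _ [q [/UU' ? ?] <-].
exact: mem_img.
Qed.

Lemma smooth_funS U U' (f : M -> R) : U' `<=` U -> smooth_fun U f -> smooth_fun U' f.
Proof.
move=> UU' sX c ac; apply: smooth_onS (sX c ac) => _ [q [/UU' ? ?] <-].
exact: mem_img.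
Qed.

Lemma eq_smooth_field U X Y : open U -> (forall q, U q -> X q = Y q) ->
  smooth_field U X -> smooth_field U Y.
Proof.
move=> oU XY sX c ac; apply: eq_smooth_on (sX c ac); first exact: open_img.
by move=> _ [q [Uq cq] <-]; rewrite !coord_fieldE // XY.
Qed.

Lemma eq_smooth_fun U (f g : M -> R) : open U -> (forall q, U q -> f q = g q) ->
  smooth_fun U f -> smooth_fun U g.
Proof.
move=> oU XY sX c ac; apply: eq_smooth_on (sX c ac); first exact: open_img.
by move=> _ [q [Uq cq] <-] /=; rewrite crdK // XY.
Qed.

Lemma smooth_fun_cst U a : smooth_fun U (fun _ => a).
Proof. by move=> c ac; exact: smooth_on_cst. Qed.

Lemma smooth_fieldD U X Y : open U -> smooth_field U X -> smooth_field U Y ->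
  smooth_field U (fun q => X q + Y q).
Proof.
move=> oU sX sY c ac.
apply: (@eq_smooth_on _ _ _ _ (fun x => coord_field c X x + coord_field c Y x)).
- exact: open_img.
- by move=> x _; rewrite /coord_field !dchartE transitionD.
- by apply: smooth_on_rVD; [exact: open_img|exact: sX|exact: sY].
Qed.

Lemma smooth_fieldZ U f X : open U -> smooth_fun U f -> smooth_field U X ->
  smooth_field U (fun q => f q *: X q).
Proof.
move=> oU sf sX c ac.
apply: (@eq_smooth_on _ _ _ _ (fun x => (f \o inv c) x *: coord_field c X x)).
- exact: open_img.
- by move=> x _; rewrite /coord_field !dchartE transitionZ.
- by apply: smooth_on_rVZ; [exact: open_img|exact: sf|exact: sX].
Qed.

Lemma smooth_fieldB U X Y : open U -> smooth_field U X -> smooth_field U Y ->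
  smooth_field U (fun q => X q - Y q).
Proof.
move=> oU sX sY; under eq_fun do rewrite -scaleN1r.
by apply: smooth_fieldD => //; apply: smooth_fieldZ => //; exact: smooth_fun_cst.
Qed.

Lemma smooth_field0 U : smooth_field U (fun _ => 0).
Proof.
move=> c ac; rewrite (_ : coord_field c _ = cst 0); first exact: smooth_on_cst.
by apply/funext => x; rewrite /coord_field dchartE transition0.
Qed.

Lemma smooth_const_field c w U : atlas M c -> U `<=` dom c -> smooth_field U (const_field c w).
Proof.
move=> ac Uc; apply: smooth_field_local => q Uq; have cq := Uc _ Uq.
exists c, (dom c); split => //; first exact: dom_open.
apply: (@eq_smooth_on _ _ _ _ (cst w)); first exact/open_img/dom_open.
  by move=> x [r [cr _] <-]; rewrite coord_fieldE ?dchart_const_field.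
exact: smooth_on_cst.
Qed.

Lemma smooth_coord c U X i : open U -> atlas M c -> U `<=` dom c ->
  smooth_field U X -> smooth_fun U (fun q => dchart c q (X q) 0 i).
Proof.
move=> oU ac Uc sX; apply: smooth_fun_local => q Uq; have cq := Uc _ Uq.
exists c, U; split => //.
exact: (smooth_on_entry i (open_img oU) (sX c ac)).
Qed.

Lemma dfun_chart U (f : M -> R) c p v : open U -> smooth_fun U f -> U p ->
  atlas M c -> dom c p ->
  dfun f p v = 'd (f \o inv c) (crd c p) (dchart c p v).
Proof.
move=> oU sf Up ac cp; rewrite /dfun /dchart.
set c0 := chart_at p.
have d1 := transition_differentiable (chart_at_atlas p) ac (chart_at_dom p) cp.
have d2 : differentiable (f \o inv c) (crd c p).
  by apply: smooth_on_differentiable (sf c ac) _; exact: mem_img.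
have E : (crd c \o inv c0) (crd c0 p) = crd c p by rewrite /= crdK //; exact: chart_at_dom.
apply: (diff_factor v (open_img (dom_open c)) _ _ E d1 d2).
  by apply: mem_img => //; exact: chart_at_dom.
by move=> x /img_inv[cx _ _] /=; rewrite crdK.
Qed.

Lemma eq_dfun U (f g : M -> R) p v : open U -> smooth_fun U f -> U p ->
  (forall q, U q -> f q = g q) -> dfun f p v = dfun g p v.
Proof.
move=> oU sf Up fg; rewrite /dfun; apply/esym; rewrite (near_eq_diff (f := f \o inv (chart_at p))) //.
  apply: (open_near_eq (open_img oU)); first exact: mem_img.
  by move=> x /img_inv[Ux _ _] /=; rewrite fg.
by apply: smooth_on_differentiable (sf _ (chart_at_atlas p)) _; exact: mem_img.
Qed.

Lemma dfun_cst a p v : dfun (fun _ : M => a) p v = 0.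
Proof.
rewrite /dfun (_ : (fun _ => a) \o _ = cst a :> (_ -> R)) //.
by rewrite diff_cst.
Qed.

Lemma dfunZ (f : M -> R) p a v : dfun f p (a *: v) = a * dfun f p v.
Proof. by rewrite /dfun linearZ. Qed.

Lemma smooth_dfun U (f : M -> R) X : open U -> smooth_fun U f -> smooth_field U X ->
  smooth_fun U (fun q => dfun f q (X q)).
Proof.
move=> oU sf sX c ac; have oT := open_img (c := c) oU.
apply: (@eq_smooth_on _ _ _ _ (fun x => 'd (f \o inv c) x (coord_field c X x))) => //.
  move=> _ [q [Uq cq] <-] /=; rewrite crdK // (dfun_chart _ oU sf Uq ac cq).
  by rewrite coord_fieldE.
by apply: smooth_on_diff_scalar => //; [exact: sf|exact: sX].
Qed.

(** The bracket is defined in the chart at p, so this is the coordinate identity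
    [diff_bracket_scalar] in that chart. *)
Lemma dfun_lie_bracket U (f : M -> R) X Y p : open U -> U p -> smooth_fun U f ->
  smooth_field U X -> smooth_field U Y ->
  dfun f p (lie_bracket X Y p) =
  dfun (fun q => dfun f q (Y q)) p (X p) - dfun (fun q => dfun f q (X q)) p (Y p).
Proof.
move=> oU Up sf sX sY; set c := chart_at p.
have ac : atlas M c by exact: chart_at_atlas.
have cp : dom c p by exact: chart_at_dom.
have oT := open_img (c := c) oU.
have Tp : (crd c @` (U `&` dom c)) (crd c p) by exact: mem_img.
have aux Z : smooth_field U Z ->
    {near crd c p, (fun x => 'd (f \o inv c) x (coord_field c Z x)) =1
       (fun q => dfun f q (Z q)) \o inv c}.
  move=> sZ; apply: (open_near_eq oT Tp) => _ [q [Uq cq] <-] /=.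
  by rewrite crdK // (dfun_chart _ oU sf Uq ac cq) coord_fieldE.
have sd Z : smooth_field U Z ->
    smooth_on (crd c @` (U `&` dom c)) (fun x => 'd (f \o inv c) x (coord_field c Z x)).
  by move=> sZ; apply: smooth_on_diff_scalar => //; [exact: sf|exact: sZ].
have E Z w : smooth_field U Z -> dfun (fun q => dfun f q (Z q)) p w =
    'd (fun x => 'd (f \o inv c) x (coord_field c Z x)) (crd c p) w.
  move=> sZ; have h := smooth_on_differentiable (sd _ sZ) Tp.
  exact: (congr1 (fun L => L w) (near_eq_diff (aux _ sZ) h)).
rewrite !E // -[X p](dchart_at p) -[Y p](dchart_at p) -!coord_fieldE //.
exact: (diff_bracket_scalar oT (sf c ac) (sX c ac) (sY c ac) Tp).
Qed.

Lemma lie_bracketC X Y p : lie_bracket X Y p = - lie_bracket Y X p.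
Proof. by rewrite /lie_bracket opprB. Qed.

End Charts.
#[global] Hint Resolve chart_at_atlas chart_at_dom : core.
Arguments smooth_field0 {R n M} U _ _.
Arguments smooth_fun_cst {R n M} U a _ _.

(** * Connections: locality and tensoriality *)

Section Tensorial.
Context {R : realType} {n : nat} {M : manifold R n}.
Implicit Types (U : set M) (X Y Z : vfield M) (f : M -> R).

Lemma smooth_field_sum (I : Type) (r : seq I) U (F : I -> vfield M) : open U ->
  (forall i, smooth_field U (F i)) -> smooth_field U (fun q => \sum_(i <- r) F i q).
Proof.
move=> oU sF; elim: r => [|i r IH].
  by under eq_fun do rewrite big_nil; exact: smooth_field0.
by under eq_fun do rewrite big_cons; exact: smooth_fieldD.
Qed.

(** Smooth on U, where it is constant. Multiplication by it turns fields that agree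
    on U into equal fields, so that linearity over functions implies locality. *)
Definition indicator U : M -> R := fun q => if `[< U q >] then 1 else 0.

Lemma indicator1 U q : U q -> indicator U q = 1.
Proof. by move=> Uq; rewrite /indicator asboolT. Qed.

Lemma smooth_indicator U : open U -> smooth_fun U (indicator U).
Proof.
move=> oU; apply: (eq_smooth_fun oU _ (smooth_fun_cst U 1)) => q Uq.
by rewrite indicator1.
Qed.

Lemma indicator_scale U X X' : (forall q, U q -> X q = X' q) ->
  (fun q => indicator U q *: X q) = (fun q => indicator U q *: X' q).
Proof.
move=> XX'; apply/funext => q; rewrite /indicator.
by case: asboolP => [/XX' ->//|_]; rewrite !scale0r.
Qed.

(** Near p a field is a combination of the coordinate fields of a chart, whose
    coefficients at p are the components of its value at p. *)
Lemma tensorial {W : lmodType R} (Phi : vfield M -> W) p :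
  (forall U f X X', open U -> U p -> smooth_fun U f ->
     smooth_field U X -> smooth_field U X' ->
     Phi (fun q => f q *: X q + X' q) = f p *: Phi X + Phi X') ->
  forall U X X', open U -> U p -> smooth_field U X -> smooth_field U X' ->
    X p = X' p -> Phi X = Phi X'.
Proof.
move=> lin U X X' oU Up sX sX' XX'.
have Phi0 : Phi (fun _ => 0) = 0.
  have := lin setT (fun _ => 1) (fun _ => 0) (fun _ => 0) openT I
    (smooth_fun_cst _ _) (smooth_field0 _) (smooth_field0 _).
  rewrite (_ : (fun q : M => 1 *: 0 + 0) = (fun _ => 0 : 'rV[R]_n)); last first.
    by apply/funext => q; rewrite scaler0 addr0.
  by rewrite scale1r => /eqP; rewrite addrC -subr_eq subrr => /eqP.
have loc U' Y Y' : open U' -> U' p -> smooth_field U' Y -> smooth_field U' Y' ->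
    (forall q, U' q -> Y q = Y' q) -> Phi Y = Phi Y'.
  move=> oU' U'p sY sY' YY'.
  have aux Z : smooth_field U' Z -> Phi Z = Phi (fun q => indicator U' q *: Z q).
    move=> sZ; have := lin U' (indicator U') Z (fun _ => 0) oU' U'p (smooth_indicator oU')
      sZ (smooth_field0 _).
    by rewrite Phi0 addr0 indicator1 // scale1r => <-; congr Phi; apply/funext => q; rewrite addr0.
  by rewrite aux // (indicator_scale YY') -aux.
set c := chart_at p; pose U' := U `&` dom c.
have oU' : open U' by apply: openI => //; exact: dom_open.
have ac : atlas M c by exact: chart_at_atlas.
have U'p : U' p by split => //; exact: chart_at_dom.
have sub : U' `<=` dom c by move=> q [].
have expand Y : smooth_field U Y ->
    Phi Y = \sum_i Y p 0 i *: Phi (const_field c (delta_mx 0 i)).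
  move=> sY; have sY' : smooth_field U' Y by apply: smooth_fieldS sY => q [].
  have scf i : smooth_field U' (const_field c (delta_mx 0 i)) by exact: smooth_const_field.
  have sco i : smooth_fun U' (fun q => dchart c q (Y q) 0 i) by exact: smooth_coord.
  have sterm i := smooth_fieldZ oU' (sco i) (scf i).
  rewrite (@loc U' Y (fun q => \sum_i dchart c q (Y q) 0 i *: const_field c (delta_mx 0 i) q)) //.
  - elim: (index_enum _) => [|i r IH].
      by under eq_fun do rewrite big_nil; rewrite big_nil.
    under eq_fun do rewrite big_cons.
    rewrite big_cons (lin U' (fun q => dchart c q (Y q) 0 i)) //.
      by rewrite IH dchart_at.
    exact: smooth_field_sum.
  - exact: smooth_field_sum.
  - by move=> q [_ cq]; exact: const_field_sum.
by rewrite !expand // XX'.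
Qed.

End Tensorial.

Section Rearrange.
Context {R : realType} {n : nat}.
Implicit Types (f d : R) (a b c z : 'rV[R]_n).

Lemma curvature_rearrange1 f d a1 a2 b1 b2 b3 c1 c2 :
  (f *: a1 + a2) - (f *: b1 + d *: b3 + b2) - (f *: c1 + (c2 - d *: b3)) =
  f *: (a1 - b1 - c1) + (a2 - b2 - c2).
Proof. by apply/rowP => i; rewrite !mxE; ring. Qed.

Lemma curvature_rearrange3 f dx dy dxy dyx a a1 a2 a' b b' c c' z :
  (f *: a + dx *: a1 + (dy *: a2 + dxy *: z + a'))
  - (f *: b + dy *: a2 + (dx *: a1 + dyx *: z + b'))
  - (f *: c + (dxy - dyx) *: z + c') =
  f *: (a - b - c) + (a' - b' - c').
Proof. by apply/rowP => i; rewrite !mxE; ring. Qed.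

End Rearrange.

Section Connections.
Context {R : realType} {n : nat} {M : manifold R n} (nabla : connection M).
Implicit Types (U : set M) (X Y Z : vfield M) (f : M -> R).

Lemma cov_tensorl U X X' Y p : open U -> U p -> smooth_field U X ->
  smooth_field U X' -> smooth_field U Y -> X p = X' p ->
  nabla X Y p = nabla X' Y p.
Proof.
move=> oU Up sX sX' sY; apply: (tensorial (Phi := fun X => nabla X Y p) _ oU Up) => //.
move=> U' f Z Z' oU' U'p sf sZ sZ'.
apply: (cov_linearl nabla (U := U' `&` U)) => //; first exact: openI.
- by apply: smooth_funS sf => q [].
- by apply: smooth_fieldS sZ => q [].
- by apply: smooth_fieldS sZ' => q [].
- by apply: smooth_fieldS sY => q [].
Qed.

(** Leibniz rule for the indicator of U, whose derivative vanishes on U. *)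
Lemma cov_localr U X Y Y' p : open U -> U p -> smooth_field U X ->
  smooth_field U Y -> (forall q, U q -> Y q = Y' q) ->
  nabla X Y p = nabla X Y' p.
Proof.
move=> oU Up sX sY YY'; have sY' : smooth_field U Y' by exact: eq_smooth_field YY' sY.
have aux Z : smooth_field U Z -> nabla X Z p = nabla X (fun q => indicator U q *: Z q) p.
  move=> sZ; rewrite (cov_leibniz nabla oU (smooth_indicator oU)) // indicator1 // scale1r.
  rewrite -(eq_dfun (U := U) (f := fun _ => 1)) ?dfun_cst ?scale0r ?addr0 //.
    exact: smooth_fun_cst.
  by move=> q Uq; rewrite indicator1.
by rewrite aux // (indicator_scale YY') -aux.
Qed.

Lemma cov_leibnizD U f X Y Y' p : open U -> U p -> smooth_fun U f ->
  smooth_field U X -> smooth_field U Y -> smooth_field U Y' ->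
  nabla X (fun q => f q *: Y q + Y' q) p =
  f p *: nabla X Y p + dfun f p (X p) *: Y p + nabla X Y' p.
Proof.
move=> oU Up sf sX sY sY'.
rewrite (cov_additiver nabla oU) //; last exact: smooth_fieldZ.
by rewrite (cov_leibniz nabla oU).
Qed.

Lemma covDl U X X' Y p : open U -> U p -> smooth_field U X ->
  smooth_field U X' -> smooth_field U Y ->
  nabla (fun q => X q + X' q) Y p = nabla X Y p + nabla X' Y p.
Proof.
move=> oU Up sX sX' sY.
have := cov_linearl nabla oU (smooth_fun_cst U 1) sX sX' sY Up.
by rewrite scale1r; under eq_fun do rewrite scale1r.
Qed.

Lemma covBr U X Y Y' p : open U -> U p -> smooth_field U X ->
  smooth_field U Y -> smooth_field U Y' ->
  nabla X (fun q => Y q - Y' q) p = nabla X Y p - nabla X Y' p.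
Proof.
move=> oU Up sX sY sY'.
have := cov_leibnizD oU Up (smooth_fun_cst U (-1)) sX sY' sY.
rewrite dfun_cst scale0r addr0 scaleN1r addrC => <-; congr (cov _ _ _ _).
by apply/funext => q; rewrite scaleN1r addrC.
Qed.

Lemma cov0r U X p : open U -> U p -> smooth_field U X ->
  nabla X (fun _ => 0) p = 0.
Proof.
move=> oU Up sX.
have := covBr oU Up sX (smooth_field0 U) (smooth_field0 U).
by rewrite !subrr.
Qed.

Lemma cov0l U Y p : open U -> U p -> smooth_field U Y ->
  nabla (fun _ => 0) Y p = 0.
Proof.
move=> oU Up sY.
have := cov_linearl nabla oU (smooth_fun_cst U 1) (smooth_field0 U) (smooth_field0 U) sY Up.
by rewrite scaler0 addr0 scale1r => /eqP; rewrite addrC -subr_eq subrr eq_sym => /eqP.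
Qed.

Hypothesis tf : torsion_free nabla.

Lemma smooth_lie_bracket U X Y : open U -> smooth_field U X -> smooth_field U Y ->
  smooth_field U (lie_bracket X Y).
Proof.
move=> oU sX sY.
apply: (eq_smooth_field oU (X := fun q => nabla X Y q - nabla Y X q)).
  by move=> q Uq; exact: tf oU sX sY q Uq.
by apply: smooth_fieldB => //; exact: cov_smooth.
Qed.

Lemma curvatureC U X Y Z p : open U -> U p -> smooth_field U X ->
  smooth_field U Y -> smooth_field U Z ->
  curvature nabla X Y Z p = - curvature nabla Y X Z p.
Proof.
move=> oU Up sX sY sZ; rewrite /curvature.
have sl := smooth_lie_bracket oU sY sX.
have := cov_linearl nabla oU (smooth_fun_cst U (-1)) sl (smooth_field0 _) sZ Up.
rewrite (cov0l oU Up sZ) addr0 scaleN1r.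
have -> : (fun q => -1 *: lie_bracket Y X q + 0) = lie_bracket X Y.
  by apply/funext => q; rewrite addr0 scaleN1r (lie_bracketC X).
by move=> ->; apply/rowP => i; rewrite !mxE; ring.
Qed.

(** The bracket of [f X + X'] with Y is rewritten with the torsion-free connection
    itself; the terms in [Y f] then cancel. *)
Lemma curvature_linear1 U f X X' Y Z p : open U -> U p -> smooth_fun U f ->
  smooth_field U X -> smooth_field U X' -> smooth_field U Y -> smooth_field U Z ->
  curvature nabla (fun q => f q *: X q + X' q) Y Z p =
  f p *: curvature nabla X Y Z p + curvature nabla X' Y Z p.
Proof.
move=> oU Up sf sX sX' sY sZ; rewrite /curvature.
have sdf : smooth_fun U (fun q => dfun f q (Y q)) by exact: smooth_dfun.
have sYX : smooth_field U (lie_bracket X Y) by exact: smooth_lie_bracket.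
have sYX' : smooth_field U (lie_bracket X' Y) by exact: smooth_lie_bracket.
have sfX : smooth_field U (fun q => f q *: X q) by exact: smooth_fieldZ.
have sfX' : smooth_field U (fun q => f q *: X q + X' q) by exact: smooth_fieldD.
have sYZ : smooth_field U (nabla Y Z) by exact: cov_smooth.
have sXZ : smooth_field U (nabla X Z) by exact: cov_smooth.
have sX'Z : smooth_field U (nabla X' Z) by exact: cov_smooth.
have sdX : smooth_field U (fun q => dfun f q (Y q) *: X q) by exact: smooth_fieldZ.
have sB : smooth_field U (fun q => lie_bracket X' Y q - dfun f q (Y q) *: X q).
  exact: smooth_fieldB.
have E1 := cov_linearl nabla oU sf sX sX' sYZ Up.
have E2 : nabla Y (nabla (fun q => f q *: X q + X' q) Z) p =
    f p *: nabla Y (nabla X Z) p + dfun f p (Y p) *: nabla X Z p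
    + nabla Y (nabla X' Z) p.
  apply: etrans (cov_leibnizD oU Up sf sY sXZ sX'Z).
  apply: (cov_localr oU Up sY); first exact: cov_smooth.
  by move=> q Uq; rewrite (cov_linearl nabla oU sf).
have E3 : nabla (lie_bracket (fun q => f q *: X q + X' q) Y) Z p =
    f p *: nabla (lie_bracket X Y) Z p
    + (nabla (lie_bracket X' Y) Z p - dfun f p (Y p) *: nabla X Z p).
  apply: (@etrans _ _ (nabla (fun q => f q *: lie_bracket X Y q
      + (lie_bracket X' Y q - dfun f q (Y q) *: X q)) Z p)).
    apply: (cov_tensorl oU Up (smooth_lie_bracket oU sfX' sY)
      (smooth_fieldD oU (smooth_fieldZ oU sf sYX) sB) sZ).
    rewrite -(tf oU sfX' sY Up) -(tf oU sX sY Up) -(tf oU sX' sY Up).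
    rewrite (cov_linearl nabla oU sf) // (cov_leibnizD oU Up) //.
    by apply/rowP => i; rewrite !mxE; ring.
  apply: (etrans (cov_linearl nabla oU sf sYX sB sZ Up)); congr (_ + _).
  have sdN : smooth_fun U (fun q => - dfun f q (Y q)).
    apply: (eq_smooth_fun oU (f := fun q => dfun f q ((-1) *: Y q))).
      by move=> q _; rewrite dfunZ mulN1r.
    apply: smooth_dfun => //; apply: smooth_fieldZ => //; exact: smooth_fun_cst.
  have := cov_linearl nabla oU sdN sX sYX' sZ Up.
  rewrite scaleNr addrC => <-; congr (cov _ _ _ _).
  by apply/funext => q; rewrite scaleNr addrC.
apply: (etrans (congr2 (fun a b => a - b) (congr2 (fun a b => a - b) E1 E2) E3)).
exact: curvature_rearrange1.
Qed.

(** The terms in which f is differentiated twice add up to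
    [X (Y f) - Y (X f) - [X, Y] f = 0]. *)
Lemma curvature_linear3 U f X Y Z Z' p : open U -> U p -> smooth_fun U f ->
  smooth_field U X -> smooth_field U Y -> smooth_field U Z -> smooth_field U Z' ->
  curvature nabla X Y (fun q => f q *: Z q + Z' q) p =
  f p *: curvature nabla X Y Z p + curvature nabla X Y Z' p.
Proof.
move=> oU Up sf sX sY sZ sZ'; rewrite /curvature.
have step V W : smooth_field U V -> smooth_field U W ->
  nabla V (nabla W (fun q => f q *: Z q + Z' q)) p =
  f p *: nabla V (nabla W Z) p + dfun f p (V p) *: nabla W Z p
  + (dfun f p (W p) *: nabla V Z p + dfun (fun q => dfun f q (W q)) p (V p) *: Z p
     + nabla V (nabla W Z') p).
  move=> sV sW.
  have sdf : smooth_fun U (fun q => dfun f q (W q)) by exact: smooth_dfun.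
  have sWZ : smooth_field U (nabla W Z) by exact: cov_smooth.
  have sWZ' : smooth_field U (nabla W Z') by exact: cov_smooth.
  have sT : smooth_field U (fun q => dfun f q (W q) *: Z q + nabla W Z' q).
    by apply: smooth_fieldD => //; exact: smooth_fieldZ.
  rewrite (@cov_localr U _ _ (fun q => f q *: nabla W Z q
      + (dfun f q (W q) *: Z q + nabla W Z' q))) //.
  - by rewrite (cov_leibnizD oU Up) // (cov_leibnizD oU Up).
  - by apply: cov_smooth => //; apply: smooth_fieldD => //; exact: smooth_fieldZ.
  - by move=> q Uq; rewrite (cov_leibnizD oU Uq) // addrA.
have E3 := cov_leibnizD oU Up sf (smooth_lie_bracket oU sX sY) sZ sZ'.
rewrite (dfun_lie_bracket oU Up sf sX sY) in E3.
apply: (etrans (congr2 (fun a b => a - b)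
  (congr2 (fun a b => a - b) (step X Y sX sY) (step Y X sY sX)) E3)).
exact: curvature_rearrange3.
Qed.

(** Linearity in the second argument is linearity in the first, by antisymmetry. *)
Lemma curvature_tensor U X Y Z p : open U -> U p -> smooth_field U X ->
  smooth_field U Y -> smooth_field U Z ->
  curvature nabla X Y Z p = curvature_at nabla p (X p) (Y p) (Z p).
Proof.
move=> oU Up sX sY sZ; rewrite /curvature_at.
set c := chart_at p; pose U' := U `&` dom c.
have oU' : open U' by apply: openI => //; exact: dom_open.
have U'p : U' p by split => //; exact: chart_at_dom.
have sub : U' `<=` dom c by move=> q [].
have subU : U' `<=` U by move=> q [].
have se w : smooth_field U' (extend p w).
  by apply: smooth_const_field => //; exact: chart_at_atlas.
have sX' := smooth_fieldS subU sX.
have sY' := smooth_fieldS subU sY.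
have sZ' := smooth_fieldS subU sZ.
have t1 X1 X2 Y1 Z1 : smooth_field U' X1 -> smooth_field U' X2 ->
    smooth_field U' Y1 -> smooth_field U' Z1 -> X1 p = X2 p ->
    curvature nabla X1 Y1 Z1 p = curvature nabla X2 Y1 Z1 p.
  move=> s1 s2 s3 s4.
  apply: (tensorial (Phi := fun X => curvature nabla X Y1 Z1 p) _ oU' U'p) => //.
  move=> U1 f A B oU1 U1p sf sA sB.
  apply: (@curvature_linear1 (U1 `&` U')) => //; first exact: openI.
  - by apply: smooth_funS sf => q [].
  - by apply: smooth_fieldS sA => q [].
  - by apply: smooth_fieldS sB => q [].
  - by apply: smooth_fieldS s3 => q [].
  - by apply: smooth_fieldS s4 => q [].
have t3 X1 Y1 Z1 Z2 : smooth_field U' X1 -> smooth_field U' Y1 ->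
    smooth_field U' Z1 -> smooth_field U' Z2 -> Z1 p = Z2 p ->
    curvature nabla X1 Y1 Z1 p = curvature nabla X1 Y1 Z2 p.
  move=> s1 s2 s3 s4.
  apply: (tensorial (Phi := fun Z => curvature nabla X1 Y1 Z p) _ oU' U'p) => //.
  move=> U1 f A B oU1 U1p sf sA sB.
  apply: (@curvature_linear3 (U1 `&` U')) => //; first exact: openI.
  - by apply: smooth_funS sf => q [].
  - by apply: smooth_fieldS s1 => q [].
  - by apply: smooth_fieldS s2 => q [].
  - by apply: smooth_fieldS sA => q [].
  - by apply: smooth_fieldS sB => q [].
rewrite (t1 X (extend p (X p))) //; last by rewrite extend_at.
rewrite (curvatureC oU' U'p) // (t1 Y (extend p (Y p))) //; last by rewrite extend_at.
rewrite -(curvatureC oU' U'p) // (t3 _ _ Z (extend p (Z p))) //.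
by rewrite extend_at.
Qed.

End Connections.

(** * Positive definite forms and metrics *)

Section PositiveForms.
Context {R : realType}.

Definition positive_form {m} (B : 'rV[R]_m -> 'rV[R]_m -> R) :=
  [/\ forall u v, B u v = B v u,
      forall a u v w, B (a *: u + v) w = a * B u w + B v w
    & forall u, u != 0 -> 0 < B u u].

Section Form.
Context {m : nat} (B : 'rV[R]_m -> 'rV[R]_m -> R).
Hypothesis hB : positive_form B.

Lemma formC u v : B u v = B v u. Proof. by case: hB. Qed.

Lemma form_linl a u v w : B (a *: u + v) w = a * B u w + B v w.
Proof. by case: hB. Qed.

Lemma formDl u v w : B (u + v) w = B u w + B v w.
Proof. by have := form_linl 1 u v w; rewrite scale1r mul1r. Qed.

Lemma form0l w : B 0 w = 0.
Proof. by have /eqP := formDl 0 0 w; rewrite addr0 -subr_eq subrr => /eqP. Qed.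

Lemma formZl a u w : B (a *: u) w = a * B u w.
Proof. by rewrite -[a *: u]addr0 form_linl form0l addr0. Qed.

Lemma formBl u v w : B (u - v) w = B u w - B v w.
Proof. by rewrite formDl -scaleN1r formZl mulN1r. Qed.

Lemma form_suml I (r : seq I) (P : pred I) (F : I -> 'rV[R]_m) w :
  B (\sum_(i <- r | P i) F i) w = \sum_(i <- r | P i) B (F i) w.
Proof.
elim: r => [|i r IH]; first by rewrite !big_nil form0l.
by rewrite !big_cons; case: (P i) => //; rewrite formDl IH.
Qed.

Lemma formDr u v w : B w (u + v) = B w u + B w v.
Proof. by rewrite !(formC w) formDl. Qed.

Lemma form0r w : B w 0 = 0. Proof. by rewrite formC form0l. Qed.

Lemma formZr a u w : B w (a *: u) = a * B w u.
Proof. by rewrite !(formC w) formZl. Qed.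

Lemma form_sumr I (r : seq I) (P : pred I) (F : I -> 'rV[R]_m) w :
  B w (\sum_(i <- r | P i) F i) = \sum_(i <- r | P i) B w (F i).
Proof. by rewrite formC form_suml; apply: eq_bigr => i _; rewrite formC. Qed.

Lemma form_eq0 u : B u u = 0 -> u = 0.
Proof.
move=> Buu; apply/eqP/negP => /negP u0.
by case: hB => _ _ /(_ _ u0); rewrite Buu ltxx.
Qed.

Lemma form_inj u u' : (forall v, B u v = B u' v) -> u = u'.
Proof.
move=> Euu'; apply/eqP; rewrite -subr_eq0; apply/eqP/form_eq0.
by rewrite formBl Euu' subrr.
Qed.

(** A vector in the kernel of the Gram matrix gives a combination of the e i of
    length zero. *)
Lemma gram_unit (e : 'I_m -> 'rV[R]_m) :
  (forall x : 'rV[R]_m, \sum_i x 0 i *: e i = 0 -> x = 0) ->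
  (\matrix_(i, j) B (e i) (e j)) \in unitmx.
Proof.
move=> free; rewrite unitmxE unitfE; apply/negP => /det0P[x x0 xG].
move/negP: x0; apply; apply/eqP/free/form_eq0.
rewrite form_sumr big1 // => j _; rewrite formZr form_suml.
have := congr1 (fun y : 'rV_m => y 0 j) xG; rewrite !mxE => E.
rewrite (eq_bigr (fun i => x 0 i * (\matrix_(i, j) B (e i) (e j)) i j)) ?E ?mulr0 //.
by move=> i _; rewrite formZl mxE.
Qed.

Lemma form_representation (l : 'rV[R]_m -> R) :
  (forall a u v, l (a *: u + v) = a * l u + l v) ->
  exists u, forall v, B u v = l v.
Proof.
move=> llin.
have l0 : l 0 = 0.
  by have /eqP := llin 1 0 0; rewrite scaler0 addr0 mul1r -subr_eq subrr eq_sym => /eqP.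
have lsum I (r : seq I) (F : I -> 'rV[R]_m) (a : I -> R) :
    l (\sum_(i <- r) a i *: F i) = \sum_(i <- r) a i * l (F i).
  by elim: r => [|i r IH]; rewrite ?big_nil // !big_cons llin IH.
pose e (i : 'I_m) : 'rV[R]_m := delta_mx 0 i.
pose G := \matrix_(i, j) B (e i) (e j).
have uG : G \in unitmx.
  by apply: gram_unit => x; rewrite -row_sum_delta.
have [x xG] : exists x, x *m G = \row_j l (e j).
  by exists ((\row_j l (e j)) *m invmx G); rewrite mulmxKV.
exists x => v.
rewrite (row_sum_delta v) form_sumr lsum; apply: eq_bigr => j _.
rewrite formZr; congr (_ * _).
have := congr1 (fun y : 'rV_m => y 0 j) xG; rewrite !mxE => <-.
rewrite {1}(row_sum_delta x) form_suml; apply: eq_bigr => i _.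
by rewrite formZl mxE.
Qed.

End Form.

(** The projection of u to the kernel of J represents the form B u on that
    kernel. *)
Lemma orthogonal_decomposition {m n} (B : 'rV[R]_m -> 'rV[R]_m -> R)
    (J : {linear 'rV[R]_m -> 'rV[R]_n}) u : positive_form B ->
  exists2 v, J v = 0 & forall w, J w = 0 -> B (u - v) w = 0.
Proof.
move=> hB; pose K := row_base (kermx (lin1_mx J)).
have kerP w : J w = 0 <-> exists x, w = x *m K.
  rewrite -(mul_rV_lin1 J); split.
    move=> /eqP; rewrite -sub_kermx -(eq_row_base (kermx _)) => /submxP[x ->].
    by exists x.
  move=> [x ->]; apply/eqP; rewrite -sub_kermx -(eq_row_base (kermx _)).
  exact: submxMl.
pose B' (x y : 'rV[R]_(\rank (kermx (lin1_mx J)))) := B (x *m K) (y *m K).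
have hB' : positive_form B'.
  split=> [x y|a x y z|x x0]; rewrite /B'.
  - exact: formC.
  - by rewrite mulmxDl -scalemxAl form_linl.
  - case: hB => _ _; apply; apply: contra_neq x0 => xK0.
    by apply: (row_free_inj (row_base_free (kermx (lin1_mx J)))); rewrite mul0mx.
have [|x Bx] := @form_representation _ B' hB' (fun y => B u (y *m K)).
  by move=> a y z; rewrite mulmxDl -scalemxAl formDr // formZr.
exists (x *m K); first by apply/kerP; exists x.
by move=> _ /kerP[y ->]; rewrite formBl // -Bx subrr.
Qed.

End PositiveForms.

Section Metric.
Context {R : realType} {n : nat} {M : manifold R n} (g : metric M).

Lemma metric_form p : positive_form (g p).
Proof.
split; [exact: inner_sym|exact: inner_linear|exact: inner_pos].
Qed.

Lemma dual_connectionsC nabla nabla' :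
  dual_connections g nabla nabla' -> dual_connections g nabla' nabla.
Proof.
move=> d U X Y Z oU sX sY sZ p Up.
have := d U X Z Y oU sX sZ sY p Up.
rewrite addrC (inner_sym g p (Z p)) (inner_sym g p (nabla X Z p)) => <-.
by congr (dfun _ _ _); apply/funext => q; exact: inner_sym.
Qed.

(** Differentiate g (Y, Z) = 0 along X. *)
Lemma dual_orthogonal nabla nabla' U X Y Z p : dual_connections g nabla nabla' ->
  open U -> U p -> smooth_field U X -> smooth_field U Y -> smooth_field U Z ->
  (forall q, U q -> g q (Y q) (Z q) = 0) ->
  g p (nabla X Y p) (Z p) = - g p (Y p) (nabla' X Z p).
Proof.
move=> d oU Up sX sY sZ YZ; have := d U X Y Z oU sX sY sZ p Up.
rewrite -(eq_dfun (U := U) (f := fun _ => 0)) ?dfun_cst //.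
- by move=> /esym/eqP; rewrite addr_eq0 => /eqP.
- exact: smooth_fun_cst.
- by move=> q /YZ ->.
Qed.

End Metric.

(** * Horizontal lifts and related fields *)

Section Lift.
Context {R : realType} {m n : nat}.
Variables (M : statistical_manifold R m) (N : statistical_manifold R n).
Variable F : M -> N.
Hypothesis hF : riemannian_submersion F.

Local Notation g1 := (stat_metric M).
Local Notation g2 := (stat_metric N).
Implicit Types (U : set M) (W : set N) (p q : M).

Lemma dmapD q u v : dmap F q (u + v) = dmap F q u + dmap F q v.
Proof. exact: linearD. Qed.

Lemma dmapZ q a u : dmap F q (a *: u) = a *: dmap F q u.
Proof. exact: linearZ. Qed.

Lemma dmapB q u v : dmap F q (u - v) = dmap F q u - dmap F q v.
Proof. exact: linearB. Qed.

Lemma open_preimage W : open W -> open (F @^-1` W).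
Proof. by case: hF => -[cF _] _ _; move/continuousP: cF; apply. Qed.

Lemma vproj_spec q u :
  vertical F q (vproj F q u) /\ horizontal F q (u - vproj F q u).
Proof.
have [v v0 hv] := orthogonal_decomposition
  ('d (crd (chart_at (F q)) \o F \o inv (chart_at q)) (crd (chart_at q) q))
  u (metric_form g1 q).
rewrite /vproj; case: xgetP => [w -> //|/(_ v)]; case.
by split => // w; exact: hv.
Qed.

Lemma vproj_unique q u v : vertical F q v -> horizontal F q (u - v) ->
  vproj F q u = v.
Proof.
move=> vv huv; have [vp hp] := vproj_spec q u.
have hB := metric_form g1 q.
have vd : vertical F q (vproj F q u - v).
  by rewrite /vertical /= dmapB vp vv subrr.
apply/eqP; rewrite -subr_eq0; apply/eqP/(form_eq0 hB).
have key d : vertical F q d -> g1 q (vproj F q u - v) d = 0.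
  move=> vd'; have := hp _ vd'; have := huv _ vd'; rewrite !(formBl hB); lra.
exact: key.
Qed.

(** The lift of w is the vector that represents the form [v |-> g2 (w, dF v)]. In
    coordinates this is a linear system whose matrix is the Gram matrix of the
    metric of M, which makes the lift smooth in q without any choice of frame. *)
Definition hlift q (w : 'rV[R]_n) : 'rV[R]_m :=
  xget 0 [set u | forall v, g1 q u v = g2 (F q) w (dmap F q v)].

Lemma hliftE q w v : g1 q (hlift q w) v = g2 (F q) w (dmap F q v).
Proof.
have [|u hu] := form_representation (metric_form g1 q)
    (l := fun v => g2 (F q) w (dmap F q v)).
  by move=> a x y; rewrite dmapD dmapZ (formDr (metric_form g2 _))
    (formZr (metric_form g2 _)).
by rewrite /hlift; case: xgetP => [u' -> //|/(_ u)].
Qed.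

Lemma hlift_horizontal q w : horizontal F q (hlift q w).
Proof. by move=> v vv; rewrite hliftE vv (form0r (metric_form g2 _)). Qed.

(** The isometry condition bears on pairs of horizontal vectors; the vertical part
    of u contributes nothing to either side. *)
Lemma metric_dmap q u w : horizontal F q w ->
  g1 q u w = g2 (F q) (dmap F q u) (dmap F q w).
Proof.
move=> hw; have [vp hp] := vproj_spec q u; have [_ _ iso] := hF.
have := iso q _ _ hp hw; rewrite dmapB vp subr0 => ->.
rewrite (formBl (metric_form g1 q)) (inner_sym g1 q (vproj F q u)) hw //.
by rewrite subr0.
Qed.

(** It is enough to test against vectors dF v with v horizontal, and for these F is
    an isometry. *)
Lemma dmap_hlift q w : dmap F q (hlift q w) = w.
Proof.
apply: (form_inj (metric_form g2 (F q))) => z.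
have [_ sur _] := hF; have [v <-] := sur q z.
have [vp hp] := vproj_spec q v.
have -> : dmap F q v = dmap F q (v - vproj F q v) by rewrite dmapB vp subr0.
by rewrite -metric_dmap // hliftE.
Qed.

Lemma hlift_dmap q u : horizontal F q u -> hlift q (dmap F q u) = u.
Proof.
move=> hu; apply: (form_inj (metric_form g1 q)) => v.
by rewrite hliftE (inner_sym g1) metric_dmap // (inner_sym g2).
Qed.

Lemma map_smooth c c' : atlas M c -> atlas N c' ->
  smooth_on (crd c @` (F @^-1` dom c' `&` dom c)) (crd c' \o F \o inv c).
Proof. by case: hF => -[_ sF] _ _ ac ac'; rewrite setIC; exact: sF. Qed.

Lemma map_differentiable c c' q : atlas M c -> atlas N c' -> dom c q ->
  dom c' (F q) -> differentiable (crd c' \o F \o inv c) (crd c q).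
Proof.
move=> ac ac' cq c'q; apply: smooth_on_differentiable (map_smooth ac ac') _.
exact: mem_img.
Qed.

Lemma dchart_dmap c c' q v : atlas M c -> atlas N c' -> dom c q ->
  dom c' (F q) ->
  dchart c' (F q) (dmap F q v) =
  'd (crd c' \o F \o inv c) (crd c q) (dchart c q v).
Proof.
move=> ac ac' cq c'q; have a0 := chart_at_atlas q; have a0' := chart_at_atlas (F q).
have c0q := chart_at_dom q; have c0'q := chart_at_dom (F q).
pose V := F @^-1` (dom (chart_at (F q))) `&` dom c.
have oV : open V by apply: openI; [apply: open_preimage; exact: dom_open|exact: dom_open].
have oT := open_img (c := chart_at q) oV.
have Tq : (crd (chart_at q) @` (V `&` dom (chart_at q))) (crd (chart_at q) q).
  exact: mem_img.
apply: (@etrans _ _ ('d (crd c' \o F \o inv (chart_at q)) (crd (chart_at q) q) v)).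
  apply/esym; apply: (diff_factor v oT Tq).
  - by move=> z /img_inv[[Vz _] _ _] /=; rewrite crdK.
  - by rewrite /= crdK.
  - exact: map_differentiable.
  - exact: transition_differentiable.
apply: (diff_factor v oT Tq).
- by move=> z /img_inv[[_ Vz] _ _] /=; rewrite crdK.
- by rewrite /= crdK.
- exact: transition_differentiable.
- exact: map_differentiable.
Qed.

Lemma smooth_fun_comp W (f : N -> R) : open W -> smooth_fun W f ->
  smooth_fun (F @^-1` W) (f \o F).
Proof.
move=> oW sf; apply: smooth_fun_local => q Wq.
set c := chart_at q; set c' := chart_at (F q).
have ac : atlas M c by exact: chart_at_atlas.
have ac' : atlas N c' by exact: chart_at_atlas.
have cq : dom c q by exact: chart_at_dom.
have c'q : dom c' (F q) by exact: chart_at_dom.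
exists c, (F @^-1` (W `&` dom c')).
have oV : open (F @^-1` (W `&` dom c')).
  by apply: open_preimage; apply: openI => //; exact: dom_open.
split => //; have oT := open_img (c := c) oV.
apply: (@eq_smooth_on _ _ _ _ ((f \o inv c') \o (crd c' \o F \o inv c))) => //.
  by move=> z /img_inv[[_ Vz] _ _] /=; rewrite crdK.
apply: (smooth_on_comp_scalar oT _ _ (smooth_fun_on sf ac')).
  by move=> z /img_inv[[Wz Vz] _ _] /=; exact: mem_img.
apply: smooth_onS (map_smooth ac ac') => z [r [[? ?] ?] <-]; exact: mem_img.
Qed.

Lemma dfun_comp W (f : N -> R) q v : open W -> smooth_fun W f -> W (F q) ->
  dfun (f \o F) q v = dfun f (F q) (dmap F q v).
Proof.
move=> oW sf Wq; set c := chart_at q; set c' := chart_at (F q).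
have ac : atlas M c by exact: chart_at_atlas.
have ac' : atlas N c' by exact: chart_at_atlas.
have cq : dom c q by exact: chart_at_dom.
have c'q : dom c' (F q) by exact: chart_at_dom.
have oV : open (F @^-1` (dom c')) by apply: open_preimage; exact: dom_open.
apply: (diff_factor (f := crd c' \o F \o inv c) v (open_img (c := c) oV)).
- exact: mem_img.
- by move=> z /img_inv[Vz _ _] /=; rewrite crdK.
- by rewrite /= crdK.
- exact: map_differentiable.
- apply: smooth_on_differentiable (smooth_fun_on sf ac') _; exact: mem_img.
Qed.

(** The inverse of the Gram matrix is smooth by Cramer's rule. Basic fields have to
    be smooth on the whole preimage of W, so the argument is carried out around an
    arbitrary point of it. *)
Lemma smooth_hlift W X' : open W -> smooth_field W X' ->
  smooth_field (F @^-1` W) (fun q => hlift q (X' (F q))).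
Proof.
move=> oW sX'; apply: smooth_field_local => q0 Wq0.
set c := chart_at q0; set c' := chart_at (F q0).
have ac : atlas M c by exact: chart_at_atlas.
have ac' : atlas N c' by exact: chart_at_atlas.
have cq0 : dom c q0 by exact: chart_at_dom.
have c'q0 : dom c' (F q0) by exact: chart_at_dom.
pose O := W `&` dom c'; have oO : open O by apply: openI => //; exact: dom_open.
exists c, (F @^-1` O); have oV := open_preimage oO; split => //.
have oT := open_img (c := c) oV; set T := crd c @` _ in oT *.
pose e (i : 'I_m) := const_field c (delta_mx 0 i).
pose e' (i : 'I_n) := const_field c' (delta_mx 0 i).
have se i : smooth_field (dom c) (e i) by exact: smooth_const_field.
have se' i : smooth_field O (e' i) by apply: smooth_const_field => // q [].
(* The components of the lift in the chart c are the row vector b *m invmx G. *)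
pose G x : 'M[R]_m := \matrix_(i, j) g1 (inv c x) (e i (inv c x)) (e j (inv c x)).
pose b x : 'rV[R]_m := \row_j g2 (F (inv c x)) (X' (F (inv c x)))
  (dmap F (inv c x) (e j (inv c x))).
have uG x : T x -> G x \in unitmx.
  move=> /img_inv[_ cx _]; apply: (gram_unit (metric_form g1 _)) => y.
  move=> /(congr1 (dchart c (inv c x))).
  have -> : dchart c (inv c x) 0 = 0 by exact: transition0.
  move=> <-; rewrite /dchart linear_sum [LHS]row_sum_delta; apply: eq_bigr => i _.
  rewrite linearZ; congr (_ *: _).
  exact: esym (dchart_const_field _ ac cx).
have sG i j : smooth_on T (fun x => G x i j).
  under eq_fun do rewrite mxE.
  have := smooth_fun_on (inner_smooth g1 (dom_open c) (se i) (se j)) ac.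
  by apply: smooth_onS => z [r [? ?] <-]; exact: mem_img.
have sX0 : smooth_field O X' by apply: smooth_fieldS sX' => q [].
have sb j : smooth_on T (fun x => b x 0 j).
  (* Expanding dF (e j) in the coordinate fields of N separates the derivatives of
     F from functions pulled back from N. *)
  pose phi l : N -> R := fun y => g2 y (X' y) (e' l y).
  have sphi l : smooth_fun O (phi l) by exact: inner_smooth.
  have sF : smooth_on T (crd c' \o F \o inv c).
    by apply: smooth_onS (map_smooth ac ac') => z [r [[? ?] ?] <-]; exact: mem_img.
  apply: (@eq_smooth_on _ _ _ _ (fun x => \sum_l
     'D_(delta_mx 0 j) (crd c' \o F \o inv c) x 0 l * (phi l \o F \o inv c) x)) => //.
    move=> z Tz; have [[_ c'z] cz crz] := img_inv Tz; rewrite /b mxE.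
    rewrite (const_field_sum (fun _ => dmap F (inv c z) (e j (inv c z))) ac' c'z).
    rewrite (form_sumr (metric_form g2 _)); apply: eq_bigr => l _.
    rewrite (formZr (metric_form g2 _)); congr (_ * _).
    rewrite (dchart_dmap _ ac ac' cz c'z) dchart_const_field // crz deriveE //.
    exact: smooth_on_differentiable sF Tz.
  apply: smooth_on_sum => // l; apply: smooth_onM => //.
    by apply: smooth_on_entry => //; exact: smooth_on_derive.
  by apply: (smooth_fun_on (smooth_fun_comp oO (sphi l)) ac).
apply: smooth_on_rV => // i.
apply: (@eq_smooth_on _ _ _ _ (fun x => \sum_j b x 0 j * invmx (G x) j i)) => //.
  move=> x Tx; have [_ cx crx] := img_inv Tx.
  set u := hlift (inv c x) (X' (F (inv c x))).
  have E : dchart c (inv c x) u *m G x = b x.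
    apply/rowP => j; rewrite !mxE -hliftE -/u.
    have Eu := const_field_sum (fun _ => u) ac cx.
    apply: etrans (congr1 (fun v => g1 (inv c x) v (e j (inv c x))) (esym Eu)).
    rewrite (form_suml (metric_form g1 _)).
    by apply: eq_bigr => k _; rewrite (formZl (metric_form g1 _)) mxE.
  rewrite -[coord_field _ _ x]/(dchart c (inv c x) u).
  by rewrite -[dchart c _ u](mulmxK (uG x Tx)) E mxE.
apply: smooth_on_sum => // j; apply: smooth_onM => //.
exact: smooth_on_invmx.
Qed.

(** Naturality of the Lie bracket under F, in the charts at p and F p. *)
Lemma related_bracket W U X Y (X' Y' : vfield N) p : open U -> U p ->
  open W -> W (F p) -> smooth_field U X -> smooth_field U Y ->
  smooth_field W X' -> smooth_field W Y' ->
  (forall q, U q -> W (F q) -> dmap F q (X q) = X' (F q)) ->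
  (forall q, U q -> W (F q) -> dmap F q (Y q) = Y' (F q)) ->
  dmap F p (lie_bracket X Y p) = lie_bracket X' Y' (F p).
Proof.
move=> oU Up oW Wp sX sY sX' sY' rX rY.
rewrite -[LHS](dchart_at (F p)).
set c := chart_at p; set c' := chart_at (F p).
have ac : atlas M c by exact: chart_at_atlas.
have ac' : atlas N c' by exact: chart_at_atlas.
have cp : dom c p by exact: chart_at_dom.
have c'p : dom c' (F p) by exact: chart_at_dom.
rewrite (dchart_dmap _ ac ac' cp c'p) dchart_at.
pose V := U `&` F @^-1` (W `&` dom c').
have oV : open V.
  by apply: openI => //; apply: open_preimage; apply: openI => //; exact: dom_open.
have oT := open_img (c := c) oV; set T := crd c @` _ in oT.
have Tp : T (crd c p) by exact: mem_img.
pose phi := crd c' \o F \o inv c.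
have sphi : smooth_on T phi.
  by apply: smooth_onS (map_smooth ac ac') => z [r [[_ [_ ?]] ?] <-]; exact: mem_img.
have sT Z : smooth_field U Z -> smooth_on T (coord_field c Z).
  move=> sZ; apply: smooth_onS (smooth_field_on sZ ac).
  by move=> z [r [[? _] ?] <-]; exact: mem_img.
have dphi := smooth_on_differentiable sphi Tp.
have phip : phi (crd c p) = crd c' (F p) by rewrite /phi /= crdK.
have aux Z Z' w : smooth_field U Z -> smooth_field W Z' ->
    (forall q, U q -> W (F q) -> dmap F q (Z q) = Z' (F q)) ->
    'd (fun y => 'd phi y (coord_field c Z y)) (crd c p) w =
    'd (coord_field c' Z') (crd c' (F p)) ('d phi (crd c p) w).
  move=> sZ sZ' rZ.
  apply: (diff_factor w oT Tp _ phip dphi).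
    move=> _ [q [[Uq [Wq c'q]] cq] <-].
    have -> : phi (crd c q) = crd c' (F q) by rewrite /phi /= crdK.
    by rewrite !coord_fieldE // -dchart_dmap // rZ.
  apply: smooth_on_differentiable (smooth_field_on sZ' ac') _; exact: mem_img.
have rel Z Z' : (forall q, U q -> W (F q) -> dmap F q (Z q) = Z' (F q)) ->
    'd phi (crd c p) (coord_field c Z (crd c p)) = coord_field c' Z' (crd c' (F p)).
  by move=> rZ; rewrite !coord_fieldE // -dchart_dmap // rZ.
have B := diff_bracket oT sphi (sT _ sX) (sT _ sY) Tp.
apply: (etrans B).
apply: (etrans (congr2 (fun a b => a - b) (aux _ _ _ sY sY' rY) (aux _ _ _ sX sX' rX))).
by rewrite (rel _ _ rX) (rel _ _ rY).
Qed.

End Lift.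

(** * The Gauss equation of a statistical submersion *)

Section Gauss.
Context {R : realType} {m n : nat}.
Variables (M : statistical_manifold R m) (N : statistical_manifold R n).
Variable F : M -> N.
Hypothesis hF : statistical_submersion F.

Local Notation g1 := (stat_metric M).
Local Notation g2 := (stat_metric N).
Local Notation nM := (stat_conn M).
Local Notation nD := (stat_dual M).
Local Notation nN := (stat_conn N).
Implicit Types (U : set M) (O : set N).

Let hR : riemannian_submersion F := hF.1.

Lemma vertical_horizontal q v u : vertical F q v -> horizontal F q u ->
  g1 q v u = 0.
Proof. by move=> vv hu; rewrite inner_sym hu. Qed.

Lemma basic_hlift O X' : open O -> smooth_field O X' ->
  basic F O (fun q => hlift F q (X' (F q))) X'.
Proof.
move=> oO sX'; split => //; first exact: smooth_hlift.
by move=> q _; split; [exact: hlift_horizontal|exact: dmap_hlift].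
Qed.

(** S is related to the zero field of N. *)
Lemma bracket_vertical U O S Z Z' p : open U -> U p -> open O -> O (F p) ->
  smooth_field U S -> (forall q, U q -> vertical F q (S q)) -> basic F O Z Z' ->
  vertical F p (lie_bracket S Z p).
Proof.
move=> oU Up oO Op sS vS [sZ sZ' rZ].
have oV : open (U `&` F @^-1` O) by apply: openI => //; exact: open_preimage.
have s1 : smooth_field (U `&` F @^-1` O) S by apply: smooth_fieldS sS => q [].
have s2 : smooth_field (U `&` F @^-1` O) Z by apply: smooth_fieldS sZ => q [].
have s3 : smooth_field O (fun _ : N => 0 : 'rV[R]_n) by exact: smooth_field0.
apply: (etrans (related_bracket hR oV (conj Up Op) oO Op s1 s2 s3 sZ' _ _)).
- by move=> q [Uq _] _; exact: vS.
- by move=> q _ Oq; have [] := rZ q Oq.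
- rewrite -(stat_conn_torsion_free oO s3 sZ' Op).
  by rewrite (cov0l nN oO Op) // (cov0r nN oO Op) // subrr.
Qed.

(** As [[S, Z]] is vertical, nabla_S Z may be replaced by nabla_Z S, and duality
    moves the derivative from S to Y. *)
Lemma cov_vertical (nabla nabla' : connection M) U O S Z Z' Y p :
  torsion_free nabla -> dual_connections g1 nabla nabla' ->
  open U -> U p -> open O -> O (F p) ->
  smooth_field U S -> (forall q, U q -> vertical F q (S q)) -> basic F O Z Z' ->
  smooth_field U Y -> (forall q, U q -> horizontal F q (Y q)) ->
  g1 p (nabla S Z p) (Y p) = - g1 p (S p) (nabla' Z Y p).
Proof.
move=> tf dual oU Up oO Op sS vS bZ sY hY.
have vB := bracket_vertical oU Up oO Op sS vS bZ.
have [sZ _ _] := bZ.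
pose V := U `&` F @^-1` O.
have oV : open V by apply: openI => //; exact: open_preimage.
have Vp : V p by split.
have subU : V `<=` U by move=> q [].
have s1 := smooth_fieldS subU sS; have s3 := smooth_fieldS subU sY.
have s2 : smooth_field V Z by apply: smooth_fieldS sZ => q [].
have := dual_orthogonal dual oV Vp s2 s1 s3 => <-; last first.
  by move=> q /subU Uq; apply: vertical_horizontal; [exact: vS|exact: hY].
apply/eqP; rewrite -subr_eq0 -(formBl (metric_form g1 p)) (tf V S Z oV s1 s2 p Vp).
by apply/eqP; apply: vertical_horizontal => //; exact: hY.
Qed.

(** The identity [A*_X Y = - A_Y X], from the vanishing of the derivative of
    g1 (X, Y) along the fibres. *)
Lemma second_form_skew U O X X' Y Y' V p : open U -> U p -> open O -> O (F p) ->
  basic F O X X' -> basic F O Y Y' ->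
  smooth_field U V -> (forall q, U q -> vertical F q (V q)) ->
  g1 p (nD X Y p) (V p) = - g1 p (nM Y X p) (V p).
Proof.
move=> oU Up oO Op bX bY sV vV.
have [sX sX' rX] := bX; have [sY sY' rY] := bY.
pose U' := U `&` F @^-1` O.
have oU' : open U' by apply: openI => //; exact: open_preimage.
have Up' : U' p by split.
have subU : U' `<=` U by move=> q [].
have subO : U' `<=` F @^-1` O by move=> q [].
have sX1 := smooth_fieldS subO sX; have sY1 := smooth_fieldS subO sY.
have sV1 := smooth_fieldS subU sV.
have hX q : U' q -> horizontal F q (X q) by move=> /subO /rX [].
have hY q : U' q -> horizontal F q (Y q) by move=> /subO /rY [].
have vV1 q : U' q -> vertical F q (V q) by move=> /subU /vV.
have D := stat_duality oU' sV1 sX1 sY1 Up'.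
have sphi : smooth_fun O (fun y => g2 y (X' y) (Y' y)) by exact: inner_smooth.
have E0 : dfun (fun q => g1 q (X q) (Y q)) p (V p) = 0.
  apply: (@etrans _ _ (dfun ((fun y => g2 y (X' y) (Y' y)) \o F) p (V p))).
    apply/esym; apply: (eq_dfun (V p) oU' _ Up').
      by apply: smooth_funS (smooth_fun_comp hR oO sphi) => q [].
    move=> q U'q; have [_ Oq] := U'q; have [_ dX] := rX q Oq; have [hYq dY] := rY q Oq.
    by rewrite /= -dX -dY (metric_dmap hR).
  rewrite (dfun_comp hR _ oO sphi Op) (vV _ Up).
  by rewrite -[0 in LHS](scale0r 0) dfunZ mul0r.
have E1 := cov_vertical (@stat_conn_torsion_free _ _ M) (@stat_duality _ _ M)
  oU' Up' oO Op sV1 vV1 bX sY1 hY.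
have E2 := cov_vertical (@stat_dual_torsion_free _ _ M)
  (dual_connectionsC (@stat_duality _ _ M)) oU' Up' oO Op sV1 vV1 bY sX1 hX.
move: D; rewrite E0 (inner_sym g1 p (X p)) E1 E2.
rewrite (inner_sym g1 p (V p)) (inner_sym g1 p (V p)); lra.
Qed.

(** Duality moves the derivative from Y to the vertical field, so that only the
    value of Y at p matters; in the argument X a connection is always tensorial. *)
Lemma second_form_tensor (nabla nabla' : connection M) U X X1 Y Y1 V p :
  dual_connections g1 nabla nabla' -> open U -> U p ->
  smooth_field U X -> smooth_field U X1 -> smooth_field U Y -> smooth_field U Y1 ->
  smooth_field U V -> (forall q, U q -> vertical F q (V q)) ->
  (forall q, U q -> horizontal F q (Y q)) ->
  (forall q, U q -> horizontal F q (Y1 q)) ->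
  X p = X1 p -> Y p = Y1 p ->
  g1 p (nabla X Y p) (V p) = g1 p (nabla X1 Y1 p) (V p).
Proof.
move=> dual oU Up sX sX1 sY sY1 sV vV hY hY1 XX1 YY1.
rewrite (dual_orthogonal dual oU Up sX sY sV); last first.
  by move=> q Uq; apply: hY => //; exact: vV.
rewrite (dual_orthogonal dual oU Up sX1 sY1 sV); last first.
  by move=> q Uq; apply: hY1 => //; exact: vV.
by rewrite YY1 (cov_tensorl nabla' oU Up sX sX1 sV XX1).
Qed.

(** For basic fields, the vertical part of nabla_Y Z. Subtracting a lift instead of
    projecting exhibits it as a smooth field on the whole of the preimage of O. *)
Definition vcov Y Z Y' Z' : vfield M :=
  fun q => nM Y Z q - hlift F q (nN Y' Z' (F q)).

Lemma smooth_vcov O Y Y' Z Z' : open O -> basic F O Y Y' -> basic F O Z Z' ->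
  smooth_field (F @^-1` O) (vcov Y Z Y' Z').
Proof.
move=> oO [sY sY' _] [sZ sZ' _].
have oV : open (F @^-1` O) by exact: open_preimage.
apply: smooth_fieldB => //; first exact: cov_smooth.
by apply: smooth_hlift => //; exact: cov_smooth.
Qed.

Lemma vertical_vcov O Y Y' Z Z' q : open O -> O (F q) ->
  basic F O Y Y' -> basic F O Z Z' -> vertical F q (vcov Y Z Y' Z' q).
Proof.
move=> oO Oq bY bZ; rewrite /vertical /= /vcov dmapB dmap_hlift //.
by rewrite (hF.2 _ _ _ _ _ oO bY bZ q Oq) subrr.
Qed.

Lemma metric_cov_basic O X X' Y Y' W W' p : open O -> O (F p) ->
  basic F O X X' -> basic F O Y Y' -> basic F O W W' ->
  g1 p (nM X Y p) (W p) = g2 (F p) (nN X' Y' (F p)) (W' (F p)).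
Proof.
move=> oO Op bX bY [_ _ rW]; have [hW dW] := rW p Op.
by rewrite (metric_dmap hR) // dW (hF.2 _ _ _ _ _ oO bX bY p Op).
Qed.

(** nabla_Y Z is the basic field over nabla_Y' Z' plus the vertical field vcov,
    whose derivative is moved to W by duality. *)
Lemma metric_second_cov O X X' Y Y' Z Z' W W' p : open O -> O (F p) ->
  basic F O X X' -> basic F O Y Y' -> basic F O Z Z' -> basic F O W W' ->
  g1 p (nM X (nM Y Z) p) (W p) =
  g2 (F p) (nN X' (nN Y' Z') (F p)) (W' (F p))
  - g1 p (vcov Y Z Y' Z' p) (nD X W p).
Proof.
move=> oO Op bX bY bZ bW.
have [sX sX' _] := bX; have [sY sY' _] := bY; have [sZ sZ' _] := bZ.
have [sW _ rW] := bW.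
have oV : open (F @^-1` O) by exact: open_preimage.
have sYZ : smooth_field (F @^-1` O) (nM Y Z) by exact: cov_smooth.
have sYZ' : smooth_field O (nN Y' Z') by exact: cov_smooth.
have bL := basic_hlift oO sYZ'; have [sL _ _] := bL.
have sT := smooth_vcov oO bY bZ.
have E : nM X (vcov Y Z Y' Z') p =
    nM X (nM Y Z) p - nM X (fun q => hlift F q (nN Y' Z' (F q))) p.
  exact: (covBr nM oV Op sX sYZ sL).
rewrite -(metric_cov_basic oO Op bX bL bW).
have D : g1 p (nM X (vcov Y Z Y' Z') p) (W p) = - g1 p (vcov Y Z Y' Z' p) (nD X W p).
  apply: (dual_orthogonal (@stat_duality _ _ M) oV Op sX sT sW) => q Oq.
  apply: vertical_horizontal; first exact: vertical_vcov bY bZ.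
  by have [] := rW q Oq.
move: D; rewrite E (formBl (metric_form g1 p)) => D.
by rewrite -D addrC subrK.
Qed.

(** For basic fields, the vertical part of [[X, Y]]. *)
Definition vbracket X Y X' Y' : vfield M :=
  fun q => lie_bracket X Y q - hlift F q (lie_bracket X' Y' (F q)).

Lemma vertical_vbracket O X X' Y Y' q : open O -> O (F q) ->
  basic F O X X' -> basic F O Y Y' -> vertical F q (vbracket X Y X' Y' q).
Proof.
move=> oO Oq [sX sX' rX] [sY sY' rY].
have oV : open (F @^-1` O) by exact: open_preimage.
rewrite /vertical /= /vbracket dmapB dmap_hlift //.
rewrite (related_bracket hR oV Oq oO Oq sX sY sX' sY') ?subrr //.
- by move=> q' _ Oq'; have [] := rX q' Oq'.
- by move=> q' _ Oq'; have [] := rY q' Oq'.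
Qed.

(** [[X, Y]] is the basic field over [[X', Y']] plus the vertical field vbracket, to
    which [cov_vertical] applies. *)
Lemma metric_bracket_cov O X X' Y Y' Z Z' W W' p : open O -> O (F p) ->
  basic F O X X' -> basic F O Y Y' -> basic F O Z Z' -> basic F O W W' ->
  g1 p (nM (lie_bracket X Y) Z p) (W p) =
  g2 (F p) (nN (lie_bracket X' Y') Z' (F p)) (W' (F p))
  - g1 p (vbracket X Y X' Y' p) (nD Z W p).
Proof.
move=> oO Op bX bY bZ bW.
have [sX sX' rX] := bX; have [sY sY' rY] := bY; have [sZ sZ' _] := bZ.
have [sW _ rW] := bW.
have oV : open (F @^-1` O) by exact: open_preimage.
have sB := smooth_lie_bracket (@stat_conn_torsion_free _ _ M) oV sX sY.
have sB' := smooth_lie_bracket (@stat_conn_torsion_free _ _ N) oO sX' sY'.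
have bL := basic_hlift oO sB'; have [sL _ _] := bL.
have sS : smooth_field (F @^-1` O) (vbracket X Y X' Y') by exact: smooth_fieldB.
have vS q : (F @^-1` O) q -> vertical F q (vbracket X Y X' Y' q).
  by move=> Oq; exact: vertical_vbracket bX bY.
have hW q : (F @^-1` O) q -> horizontal F q (W q) by move=> Oq; have [] := rW q Oq.
have E : nM (lie_bracket X Y) Z p =
    nM (fun q => hlift F q (lie_bracket X' Y' (F q))) Z p + nM (vbracket X Y X' Y') Z p.
  rewrite -(covDl nM oV Op sL sS sZ); congr (cov _ _ _ _).
  by apply/funext => q; rewrite /vbracket addrC subrK.
rewrite E (formDl (metric_form g1 p)) (metric_cov_basic oO Op bL bZ bW).
congr (_ + _).
exact: (cov_vertical (@stat_conn_torsion_free _ _ M) (@stat_duality _ _ M)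
  oV Op oO Op sS vS bZ sW hW).
Qed.

Lemma gauss_equation O X X' Y Y' Z Z' W W' p : open O -> O (F p) ->
  basic F O X X' -> basic F O Y Y' -> basic F O Z Z' -> basic F O W W' ->
  g1 p (curvature nM X Y Z p) (W p) =
  g2 (F p) (curvature nN X' Y' Z' (F p)) (W' (F p))
  - g1 p (vcov Y Z Y' Z' p) (nD X W p) + g1 p (vcov X Z X' Z' p) (nD Y W p)
  + g1 p (vbracket X Y X' Y' p) (nD Z W p).
Proof.
move=> oO Op bX bY bZ bW.
have E1 := metric_second_cov oO Op bX bY bZ bW.
have E2 := metric_second_cov oO Op bY bX bZ bW.
have E3 := metric_bracket_cov oO Op bX bY bZ bW.
have -> : g1 p (curvature nM X Y Z p) (W p) = g1 p (nM X (nM Y Z) p) (W p)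
    - g1 p (nM Y (nM X Z) p) (W p) - g1 p (nM (lie_bracket X Y) Z p) (W p).
  by rewrite /curvature !(formBl (metric_form g1 p)).
have -> : g2 (F p) (curvature nN X' Y' Z' (F p)) (W' (F p)) =
    g2 (F p) (nN X' (nN Y' Z') (F p)) (W' (F p))
    - g2 (F p) (nN Y' (nN X' Z') (F p)) (W' (F p))
    - g2 (F p) (nN (lie_bracket X' Y') Z' (F p)) (W' (F p)).
  by rewrite /curvature !(formBl (metric_form g2 (F p))).
by rewrite E1 E2 E3; ring.
Qed.

End Gauss.

(** * Components in the adapted frames *)

Lemma form_parseval {R : realType} {m k : nat} (B : 'rV[R]_m -> 'rV[R]_m -> R)
    (e : 'I_k -> 'rV[R]_m) t u : positive_form B ->
  (forall i j, B (e i) (e j) = (i == j)%:R) ->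
  (exists a : 'I_k -> R, t = \sum_i a i *: e i) ->
  B t u = \sum_i B t (e i) * B (e i) u.
Proof.
move=> hB orth [a ->]; rewrite (form_suml hB); apply: eq_bigr => i _.
rewrite (formZl hB); congr (_ * _); rewrite (form_suml hB) (bigD1 i) //=.
rewrite (formZl hB) orth eqxx mulr1 big1 ?addr0 // => j ji.
by rewrite (formZl hB) orth (negPf ji) mulr0.
Qed.

Section Atensor.
Context {R : realType} {m n : nat}.
Variables (M : statistical_manifold R m) (N : statistical_manifold R n).
Variable F : M -> N.
Hypothesis hF : statistical_submersion F.

Local Notation g1 := (stat_metric M).
Local Notation g2 := (stat_metric N).
Local Notation nM := (stat_conn M).
Local Notation nD := (stat_dual M).
Local Notation nN := (stat_conn N).

Let hR : riemannian_submersion F := hF.1.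

Lemma vproj_horizontal q u : horizontal F q u -> vproj F q u = 0.
Proof.
move=> hu; apply: vproj_unique; last by rewrite subr0.
by rewrite /vertical /= /dmap linear0.
Qed.

Lemma metric_vproj q u v : vertical F q v -> g1 q (vproj F q u) v = g1 q u v.
Proof.
move=> vv; have [_ /(_ _ vv)] := vproj_spec F q u.
by rewrite (formBl (metric_form g1 q)) => /eqP; rewrite subr_eq0 => /eqP.
Qed.

(** On U the horizontal parts are the fields themselves and the vertical part of G
    vanishes; locality of the connection discards the values outside U. *)
Lemma AtensorE (nabla : connection M) (U : set M) E G p : open U -> U p ->
  smooth_field U E -> smooth_field U G ->
  (forall q, U q -> horizontal F q (E q)) ->
  (forall q, U q -> horizontal F q (G q)) ->
  Atensor F nabla E G p = vproj F p (nabla E G p).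
Proof.
move=> oU Up sE sG hE hG; rewrite /Atensor.
have eE q : U q -> E q = hproj F q (E q).
  by move=> Uq; rewrite /hproj vproj_horizontal ?subr0 //; exact: hE.
have eG q : U q -> G q = hproj F q (G q).
  by move=> Uq; rewrite /hproj vproj_horizontal ?subr0 //; exact: hG.
have sE' := eq_smooth_field oU eE sE; have sG' := eq_smooth_field oU eG sG.
rewrite -(cov_tensorl nabla oU Up sE sE' sG' (eE p Up)).
rewrite -(cov_localr nabla oU Up sE sG eG).
rewrite -(cov_localr nabla oU Up sE' (smooth_field0 U)); last first.
  by move=> q Uq; rewrite vproj_horizontal //; exact: hG.
rewrite (cov0r nabla oU Up sE').
have -> : hproj F p 0 = 0; last by rewrite addr0.
rewrite /hproj vproj_horizontal ?subr0 // => v _.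
exact: form0l (metric_form g1 p) _.
Qed.

Lemma curvHE p u v w z : horizontal F p z ->
  curvH F p u v w z =
  g2 (F p) (curvature_at nN (F p) (dmap F p u) (dmap F p v) (dmap F p w)) (dmap F p z).
Proof.
move=> hz; set r := curvature_at _ _ _ _ _; rewrite /curvH /curvH_vec -/r.
case: xgetP => [x _ [hx <-]|/(_ (hlift F p r))]; first exact: metric_dmap.
by case; split; [exact: hlift_horizontal|exact: dmap_hlift].
Qed.

Lemma metric_vcov Y Z Y' Z' p v : vertical F p v ->
  g1 p (vcov F Y Z Y' Z' p) v = g1 p (nM Y Z p) v.
Proof.
move=> vv; rewrite (formBl (metric_form g1 p)).
by rewrite hlift_horizontal // subr0.
Qed.

Lemma metric_vbracket U X Y X' Y' p v : open U -> U p ->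
  smooth_field U X -> smooth_field U Y -> vertical F p v ->
  g1 p (vbracket F X Y X' Y' p) v = g1 p (nM X Y p) v - g1 p (nM Y X p) v.
Proof.
move=> oU Up sX sY vv.
have E := stat_conn_torsion_free oU sX sY Up.
rewrite (formBl (metric_form g1 p)) hlift_horizontal // subr0.
by rewrite -E (formBl (metric_form g1 p)).
Qed.

Variables (p : M) (r s : nat) (U : set M).
Hypotheses (oU : open U) (Up : U p).
Variables (V : 'I_r -> vfield M) (h : 'I_s.+1 -> vfield M).
Hypothesis V_frame : orthonormal_frame g1 U (vertical F) V.
Hypothesis h_frame : orthonormal_frame g1 U (horizontal F) h.

Let A alpha i j : R := g1 p (Atensor F nM (h i) (h j) p) (V alpha p).
Let Astar alpha i j : R := g1 p (Atensor F nD (h i) (h j) p) (V alpha p).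

Let vV alpha q : U q -> vertical F q (V alpha q).
Proof. by move=> Uq; have [] := V_frame.2 q Uq. Qed.

Let hh i q : U q -> horizontal F q (h i q).
Proof. by move=> Uq; have [] := h_frame.2 q Uq. Qed.

Let sV alpha : smooth_field U (V alpha).
Proof. exact: V_frame.1. Qed.

Let sh i : smooth_field U (h i).
Proof. exact: h_frame.1. Qed.

Lemma vertical_parseval t u : vertical F p t ->
  g1 p t u = \sum_alpha g1 p t (V alpha p) * g1 p (V alpha p) u.
Proof.
have [_ orth span] := V_frame.2 p Up.
by move=> vt; apply: (form_parseval u (metric_form g1 p) orth); exact: span.
Qed.

Lemma Atensor_frame (nabla : connection M) alpha i j :
  g1 p (Atensor F nabla (h i) (h j) p) (V alpha p) =
  g1 p (nabla (h i) (h j) p) (V alpha p).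
Proof.
rewrite (AtensorE nabla oU Up) // ?metric_vproj //; [exact: vV|exact: hh|exact: hh].
Qed.

Lemma trace_norm : g1 p (traceA F h p) (traceA F h p) =
  \sum_alpha (\sum_i A alpha i i) ^+ 2.
Proof.
have vA i : vertical F p (Atensor F nM (h i) (h i) p).
  rewrite (AtensorE nM oU Up) //; [|exact: hh|exact: hh].
  by have [] := vproj_spec F p (nM (h i) (h i) p).
rewrite vertical_parseval; last first.
  rewrite /vertical /= /traceA /dmap linear_sum big1 // => i _.
  exact: vA.
apply: eq_bigr => alpha _; rewrite expr2 (inner_sym g1 p (V alpha p)).
by rewrite /traceA (form_suml (metric_form g1 p)).
Qed.

(** Replace the frame by the basic fields that agree with it at p, apply the Gauss
    equation and eliminate A*_ii, A*_ji and A_ji by skewness. *)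
Lemma sectional_identity i j :
  curvM p (h i p) (h j p) (h j p) (h i p) =
  curvH F p (h i p) (h j p) (h j p) (h i p)
  + \sum_alpha (A alpha i i * A alpha j j - 2 * A alpha i j ^+ 2
                - A alpha i j * Astar alpha i j).
Proof.
pose O := dom (chart_at (F p)).
have oO : open O by exact: dom_open.
have Op : O (F p) by exact: chart_at_dom.
(* The curvature of N at F p is by definition that of these coordinate fields. *)
pose X' k := extend (F p) (dmap F p (h k p)).
pose X k := fun q => hlift F q (X' k (F q)).
have bX k : basic F O (X k) (X' k).
  by apply: basic_hlift => //; apply: smooth_const_field => //; exact: chart_at_atlas.
have Xp k : X k p = h k p.
  by rewrite /X /X' extend_at hlift_dmap //; exact: hh.
pose U' := U `&` F @^-1` O.
have oU' : open U' by apply: openI => //; exact: open_preimage.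
have Up' : U' p by split.
have subU : U' `<=` U by move=> q [].
have subO : U' `<=` F @^-1` O by move=> q [].
have sX k : smooth_field U' (X k) by have [sX _ _] := bX k; exact: smooth_fieldS sX.
have sh' k : smooth_field U' (h k) by exact: smooth_fieldS (sh k).
have sV' a : smooth_field U' (V a) by exact: smooth_fieldS (sV a).
have hX k q : U' q -> horizontal F q (X k q).
  by move=> /subO Oq; have [_ _ rX] := bX k; have [] := rX q Oq.
have hh' k q : U' q -> horizontal F q (h k q) by move=> /subU; exact: hh.
have vV' a q : U' q -> vertical F q (V a q) by move=> /subU; exact: vV.
have AX a k l : g1 p (nM (X k) (X l) p) (V a p) = A a k l.
  rewrite /A Atensor_frame; apply: (second_form_tensor (@stat_duality _ _ M) oU' Up') => //.
  - exact: vV'.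
  - exact: hX.
  - exact: hh'.
have AsX a k l : g1 p (nD (X k) (X l) p) (V a p) = Astar a k l.
  rewrite /Astar Atensor_frame.
  apply: (second_form_tensor (dual_connectionsC (@stat_duality _ _ M)) oU' Up') => //.
  - exact: vV'.
  - exact: hX.
  - exact: hh'.
have skew a k l : Astar a k l = - A a l k.
  by rewrite -AX -AsX (second_form_skew hF oU Up oO Op (bX k) (bX l)) //; exact: vV.
have cM : curvM p (h i p) (h j p) (h j p) (h i p) =
    g1 p (curvature nM (X i) (X j) (X j) p) (X i p).
  rewrite (curvature_tensor (@stat_conn_torsion_free _ _ M) oU' Up') // !Xp.
  by [].
have cH : curvH F p (h i p) (h j p) (h j p) (h i p) =
    g2 (F p) (curvature nN (X' i) (X' j) (X' j) (F p)) (X' i (F p)).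
  by rewrite curvHE; [rewrite {4}/X' extend_at|exact: hh].
rewrite cM cH (gauss_equation hF oO Op (bX i) (bX j) (bX j) (bX i)).
have vT k l : vertical F p (vcov F (X k) (X l) (X' k) (X' l) p).
  exact: vertical_vcov (bX k) (bX l).
have vS : vertical F p (vbracket F (X i) (X j) (X' i) (X' j) p).
  exact: vertical_vbracket (bX i) (bX j).
rewrite (vertical_parseval _ (vT j j)) (vertical_parseval _ (vT i j)).
rewrite (vertical_parseval _ vS) -!addrA; congr (_ + _).
rewrite -sumrN -!big_split /=; apply: eq_bigr => a _.
have vVp : vertical F p (V a p) by exact: vV.
rewrite !metric_vcov // (metric_vbracket _ _ oU' Up') //.
rewrite !(inner_sym g1 p (V a p)) !AX !AsX.
have Aji : A a j i = - Astar a i j by rewrite skew opprK.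
rewrite (skew a i i) (skew a j i) Aji.
move: (A a i i) (A a j j) (A a i j) (Astar a i j) => x y z w; ring.
Qed.

End Atensor.

(** * Completing the squares *)

Lemma ricci_algebra {R : realType} (r s : nat) (A B : 'I_r -> 'I_s.+1 -> 'I_s.+1 -> R)
  (K H : 'I_s.+1 -> R) :
  (forall j, K j = H j + \sum_a (A a ord0 ord0 * A a j j - 2 * A a ord0 j ^+ 2
                - A a ord0 j * B a ord0 j)) ->
  \sum_(j < s.+1 | j != ord0) K j =
  \sum_(j < s.+1 | j != ord0) H j + 4^-1 * \sum_a (\sum_i A a i i) ^+ 2
  + 8^-1 * \sum_a \sum_(j < s.+1 | j != ord0) B a ord0 j ^+ 2
  - 2 * \sum_a \sum_(j < s.+1 | j != ord0) (A a ord0 j + 4^-1 * B a ord0 j) ^+ 2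
  - 4^-1 * \sum_a (A a ord0 ord0 - \sum_(j < s.+1 | j != ord0) A a j j) ^+ 2.
Proof.
move=> E; rewrite (eq_bigr _ (fun j _ => E j)) big_split /= exchange_big /=.
rewrite -!addrA; congr (_ + _); rewrite !mulr_sumr -!sumrN -!big_split /=.
apply: eq_bigr => a _.
have E1 : \sum_i A a i i = A a ord0 ord0 + \sum_(j < s.+1 | j != ord0) A a j j.
  by rewrite (bigD1 ord0).
(* - 2 x^2 - x y = y^2/8 - 2 (x + y/4)^2 *)
have E2 : \sum_(j < s.+1 | j != ord0) (A a ord0 ord0 * A a j j
      - 2 * A a ord0 j ^+ 2 - A a ord0 j * B a ord0 j) =
    A a ord0 ord0 * (\sum_(j < s.+1 | j != ord0) A a j j)
    + (8^-1 * \sum_(j < s.+1 | j != ord0) B a ord0 j ^+ 2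
       - 2 * \sum_(j < s.+1 | j != ord0) (A a ord0 j + 4^-1 * B a ord0 j) ^+ 2).
  by rewrite !mulr_sumr -sumrN -!big_split /=; apply: eq_bigr => j _; field.
(* a b = (a + b)^2/4 - (a - b)^2/4 *)
by rewrite E1 E2; field.
Qed.

Lemma sum_sq_eq0 {R : realType} (I : finType) (P : pred I) (f : I -> R) :
  \sum_(i | P i) f i ^+ 2 = 0 -> forall i, P i -> f i = 0.
Proof.
move=> /eqP; rewrite psumr_eq0; last by move=> i _; exact: sqr_ge0.
by move=> /allP h i Pi; have := h i (mem_index_enum i); rewrite Pi sqrf_eq0 => /eqP.
Qed.

(** Both dropped sums are nonnegative, and they vanish together exactly when all
    their squares do. *)
Lemma ricci_conclusion {R : realType} (r s : nat) (A B : 'I_r -> 'I_s.+1 -> 'I_s.+1 -> R)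
  (Ric bound : R) :
  Ric = bound
  - 2 * \sum_a \sum_(j < s.+1 | j != ord0) (A a ord0 j + 4^-1 * B a ord0 j) ^+ 2
  - 4^-1 * \sum_a (A a ord0 ord0 - \sum_(j < s.+1 | j != ord0) A a j j) ^+ 2 ->
  [/\ Ric <= bound
       - 2 * \sum_a \sum_(j < s.+1 | j != ord0) (A a ord0 j + 4^-1 * B a ord0 j) ^+ 2,
      Ric <= bound
    & Ric = bound <->
      forall a, A a ord0 ord0 = \sum_(j < s.+1 | j != ord0) A a j j /\
        (forall j, j != ord0 -> A a ord0 j = - (4^-1) * B a ord0 j)].
Proof.
set P := \sum_a _; set Q := \sum_a (_ - _) ^+ 2 => E.
have P0 : 0 <= P by apply: sumr_ge0 => a _; apply: sumr_ge0 => j _; exact: sqr_ge0.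
have Q0 : 0 <= Q by apply: sumr_ge0 => a _; exact: sqr_ge0.
split; [rewrite E; lra|rewrite E; lra|split].
  move=> Eb; have P00 : P = 0 by lra.
  have Q00 : Q = 0 by lra.
  move=> a; split.
    by apply/eqP; rewrite -subr_eq0; apply/eqP; apply: (sum_sq_eq0 Q00).
  move=> j j0; have Pa : \sum_(j < s.+1 | j != ord0) (A a ord0 j + 4^-1 * B a ord0 j) ^+ 2 = 0.
    move/eqP: P00; rewrite psumr_eq0; last first.
      by move=> b _; apply: sumr_ge0 => k _; exact: sqr_ge0.
    by move=> /allP/(_ a (mem_index_enum a)) /eqP.
  have := sum_sq_eq0 Pa j0; lra.
move=> eqs; rewrite E.
have -> : P = 0.
  apply: big1 => a _; apply: big1 => j j0; have [_ ->//] := eqs a.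
  by rewrite mulNr addNr expr0n.
have -> : Q = 0.
  by apply: big1 => a _; have [-> _] := eqs a; rewrite subrr expr0n.
by rewrite !mulr0 !subr0.
Qed.

Theorem theorem4p1 (R : realType) (m n : nat)
    (M : statistical_manifold R m) (N : statistical_manifold R n)
    (F : M -> N) (hF : statistical_submersion F)
    (p : M) (h1 : 'rV[R]_m) (h1_horizontal : horizontal F p h1)
    (h1_unit : stat_metric M p h1 h1 = 1)
    (r s : nat) (U : set M) (U_open : open U) (Up : U p)
    (V : 'I_r -> vfield M)
    (V_frame : orthonormal_frame (stat_metric M) U (vertical F) V)
    (h : 'I_s.+1 -> vfield M)
    (h_frame : orthonormal_frame (stat_metric M) U (horizontal F) h)
    (h_first : h ord0 p = h1) :
  let g := stat_metric M in
  let A (alpha : 'I_r) (i j : 'I_s.+1) : R :=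
    g p (Atensor F (stat_conn M) (h i) (h j) p) (V alpha p) in
  let Astar (alpha : 'I_r) (i j : 'I_s.+1) : R :=
    g p (Atensor F (stat_dual M) (h i) (h j) p) (V alpha p) in
  let hp (i : 'I_s.+1) : 'rV[R]_m := h i p in
  let bound : R :=
    RicH F p hp + 4^-1 * g p (traceA F h p) (traceA F h p)
    + 8^-1 * \sum_(alpha < r) \sum_(j < s.+1 | j != ord0)
               Astar alpha ord0 j ^+ 2 in
  [/\ RicM p hp <=
        bound - 2 * \sum_(alpha < r) \sum_(j < s.+1 | j != ord0)
                      (A alpha ord0 j + 4^-1 * Astar alpha ord0 j) ^+ 2,
      RicM p hp <= bound
    & RicM p hp = bound <->
      forall alpha : 'I_r,
        A alpha ord0 ord0 = \sum_(j < s.+1 | j != ord0) A alpha j j /\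
        (forall j : 'I_s.+1, j != ord0 ->
          A alpha ord0 j = - (4^-1) * Astar alpha ord0 j)].
Proof.
move=> g A Astar hp bound.
apply: (@ricci_conclusion _ r s A Astar (RicM p hp) bound).
have key j := sectional_identity hF U_open Up V_frame h_frame ord0 j.
rewrite /bound /g (trace_norm U_open Up V_frame h_frame).
exact: (ricci_algebra key).
Qed.
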